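(* Let $R$ be a regular finitely generated algebra over an $F$-finite regular local ring of characteristic $p>0$. Let $N$ be a finitely generated unit $R[F]$-module. If $n_1,\ldots,n_t$ are generators (as an $R$-module) of a root of $N$, then $n_1,\ldots,n_t$ generate $N$ as a $D_R$-module.
   Context: Rings are commutative. A ring $A$ of characteristic $p$ is $F$-finite if it is a finitely generated module over its subring $A^p$ of $p$-th powers; $R^{p^s}$ is the subring of $p^s$-th powers. $R[F]$ is the ring extension of $R$ generated by a variable $F$ subject to $Fr=r^pF$ for all $r\in R$; a (left) $R[F]$-module is an $R$-module $N$ with an additive map $F:N\to N$ satisfying $F(rn)=r^pF(n)$. Let $R^{(s)}$ be $R$ with its usual left $R$-structure and right $R$-structure $r'\cdot r=r^{p^s}r'$, and put $F^{s*}N=R^{(s)}\otimes_R N$, $F^*=F^{1*}$. $N$ is a unit $R[F]$-module if $\theta_N:F^*N\to N$, $r\otimes n\mapsto rF(n)$, is bijective; it is finitely generated if it is finitely generated as an $R[F]$-module. For an $R$-submodule $N_0\subseteq N$ of a unit $R[F]$-module, $F^{s*}N_0$ is identified with its image in $N$, i.e. the $R$-submodule generated by $\{F^s(n):n\in N_0\}$. A root of $N$ is an $R$-submodule $N_0\subseteq N$ that is finitely generated as an $R$-module and satisfies $N_0\subseteq F^*N_0$ and $\bigcup_s F^{s*}N_0=N$. Differential operators $\delta:R\to R$ of order $\le n$ are defined inductively: those of order $0$ are the multiplications $\tilde r$ by elements $r\in R$; those of order $\le n$ are the additive maps $\delta$ with $\delta\circ\tilde r-\tilde r\circ\delta$ of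 order $\le n-1$ for all $r\in R$. They form the ring $D_R$, and $D_R\subseteq\bigcup_s\operatorname{End}_{R^{p^s}}(R)$. A unit $R[F]$-module $N$ is a left $D_R$-module as follows: let $\theta_s=F^{(s-1)*}(\theta_N^{-1})\circ\cdots\circ F^*(\theta_N^{-1})\circ\theta_N^{-1}:N\to F^{s*}N$; an element $u\in\operatorname{End}_{R^{p^s}}(R)$ acts on $N$ by $\theta_s^{-1}\circ(u\otimes\operatorname{id}_N)\circ\theta_s$ (independent of the choice of $s$). *)

(* Defs.v *)
From HB Require Import structures.
From mathcomp Require Import all_boot all_algebra generic_quotient.
From mathcomp Require Import boolp classical_sets.

Set Implicit Arguments.
Unset Strict Implicit.
Unset Printing Implicit Defensive.

Import GRing.Theory.
Local Open Scope quotient_scope.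
Local Open Scope classical_set_scope.
Local Open Scope ring_scope.

Section Submodules.
Variables (R : pzRingType) (N : lmodType R).

Definition submodule (M : set N) : Prop :=
  M 0 /\ forall (a : R) (x y : N), M x -> M y -> M (a *: x + y).

Definition submod_span (X : set N) : set N := smallest submodule X.

Definition fg_submodule (M : set N) : Prop :=
  exists (t : nat) (g : 'I_t -> N), M = submod_span (range g).

End Submodules.

Section RegularRings.
Variable R : comPzRingType.

Definition ideal (I : set R) : Prop := @submodule R R^o I.

Definition ideal_gen (X : set R) : set R := @submod_span R R^o X.

Definition noetherian : Prop := forall I : set R, ideal I -> @fg_submodule R R^o I.

Definition prime_ideal (P : set R) : Prop :=
  [/\ ideal P, ~ P 1 & forall x y : R, P (x * y) -> P x \/ P y].

Definition maximal_ideal (M : set R) : Prop :=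
  [/\ ideal M, ~ M 1 &
      forall J : set R, ideal J -> ~ J 1 -> M `<=` J -> J = M].

Definition prime_chain (d : nat) (P : nat -> set R) : Prop :=
  (forall i : nat, (i <= d)%N -> prime_ideal (P i)) /\
  (forall i : nat, (i < d)%N -> P i `<=` P i.+1 /\ P i <> P i.+1).

Definition krull_dim (d : nat) : Prop :=
  (exists P : nat -> set R, prime_chain d P) /\
  (forall (e : nat) (P : nat -> set R), prime_chain e P -> (e <= d)%N).

Definition regular_local : Prop :=
  noetherian /\
  exists M : set R,
    [/\ maximal_ideal M,
        forall M' : set R, maximal_ideal M' -> M' = M &
        exists (d : nat) (x : 'I_d -> R), krull_dim d /\ M = ideal_gen (range x)].

(* [iota : R -> S] exhibits [S] as the ring of fractions of [R] with
   denominators outside [P]. *)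
Definition is_localization (P : set R) (S : comPzRingType)
    (iota : {rmorphism R -> S}) : Prop :=
  [/\ forall s : R, ~ P s -> exists v : S, iota s * v = 1,
      forall y : S, exists r s : R, ~ P s /\ y * iota s = iota r &
      forall r : R, iota r = 0 -> exists s : R, ~ P s /\ s * r = 0].

End RegularRings.

Definition regular_ring (R : comPzRingType) : Prop :=
  noetherian R /\
  forall P : set R, prime_ideal P ->
    exists (S : comPzRingType) (iota : {rmorphism R -> S}),
      is_localization P iota /\ regular_local S.

Definition F_finite (p : nat) (A : comPzRingType) : Prop :=
  exists (k : nat) (a : 'I_k -> A),
    forall x : A, exists c : 'I_k -> A, x = \sum_i c i ^+ p * a i.

Definition subring (R : pzRingType) (S : set R) : Prop :=
  [/\ S 1, forall x y : R, S x -> S y -> S (x - y) &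
           forall x y : R, S x -> S y -> S (x * y)].

Definition fg_algebra (A R : comPzRingType) (phi : {rmorphism A -> R}) : Prop :=
  exists (k : nat) (x : 'I_k -> R),
    forall S : set R, subring S -> range phi `<=` S -> range x `<=` S ->
      S = setT.

(* Frobenius pullback [F^{s*} N = R^{(s)} (x)_R N]: formal sums of pairs
   [(r, n)], modulo the relations of the tensor product; the right action of
   [a] on [R^{(s)}] is multiplication by [a ^+ (p ^ s)]. *)

Section Pullback.
Variables (p s : nat) (R : comPzRingType) (N : lmodType R).
Implicit Types (l : seq (R * N)) (r a : R) (n : N).

Inductive tens_rel : seq (R * N) -> seq (R * N) -> Prop :=
| tens_refl l : tens_rel l l
| tens_sym l1 l2 : tens_rel l1 l2 -> tens_rel l2 l1
| tens_trans l1 l2 l3 : tens_rel l1 l2 -> tens_rel l2 l3 -> tens_rel l1 l3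
| tens_cat l1 l2 l3 l4 : tens_rel l1 l2 -> tens_rel l3 l4 ->
    tens_rel (l1 ++ l3) (l2 ++ l4)
| tens_catC l1 l2 : tens_rel (l1 ++ l2) (l2 ++ l1)
| tens_addl r r' n : tens_rel [:: (r + r', n)] [:: (r, n); (r', n)]
| tens_addr r n n' : tens_rel [:: (r, n + n')] [:: (r, n); (r, n')]
| tens_zero n : tens_rel [:: (0, n)] [::]
| tens_balanced r a n :
    tens_rel [:: (r * a ^+ (p ^ s), n)] [:: (r, a *: n)].

Definition tens_eq l1 l2 : bool := `[< tens_rel l1 l2 >].

Lemma tens_eq_refl : reflexive tens_eq.
Proof. by move=> l; apply/asboolP; exact: tens_refl. Qed.

Lemma tens_eq_sym : symmetric tens_eq.
Proof. by move=> l1 l2; apply/asboolP/asboolP; exact: tens_sym. Qed.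

Lemma tens_eq_trans : transitive tens_eq.
Proof.
by move=> l2 l1 l3 /asboolP h1 /asboolP h2; apply/asboolP; exact: tens_trans h2.
Qed.

Canonical tens_equiv := EquivRel tens_eq tens_eq_refl tens_eq_sym tens_eq_trans.

Definition Fpull : Type := {eq_quot tens_equiv}.
HB.instance Definition _ := Choice.on Fpull.
HB.instance Definition _ := EqQuotient.on Fpull.

Definition fsum l : Fpull := \pi_Fpull l.

Lemma fsumP l1 l2 : fsum l1 = fsum l2 <-> tens_rel l1 l2.
Proof.
split=> [/eqquotP /asboolP //|h].
by apply/eqquotP; apply/asboolP.
Qed.

Lemma fsum_repr (z : Fpull) : fsum (repr z) = z.
Proof. exact: reprK. Qed.

Lemma repr_fsum l : tens_rel (repr (fsum l)) l.
Proof. by apply/fsumP; rewrite fsum_repr. Qed.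

Lemma fsum_ind (P : Fpull -> Prop) : (forall l, P (fsum l)) -> forall z, P z.
Proof. by move=> h z; rewrite -(fsum_repr z). Qed.

Definition Fpull_add (z w : Fpull) : Fpull := fsum (repr z ++ repr w).
Definition Fpull_scale r (z : Fpull) : Fpull :=
  fsum [seq (r * x.1, x.2) | x <- repr z].

Lemma Fpull_addE l1 l2 : Fpull_add (fsum l1) (fsum l2) = fsum (l1 ++ l2).
Proof. by apply/fsumP; apply: tens_cat; exact: repr_fsum. Qed.

Lemma tens_rel_scale r l1 l2 : tens_rel l1 l2 ->
  tens_rel [seq (r * x.1, x.2) | x <- l1] [seq (r * x.1, x.2) | x <- l2].
Proof.
elim=> {l1 l2} [l|l1 l2 _|l1 l2 l3 _ h1 _|l1 l2 l3 l4 _ h1 _ h2|l1 l2|||n|] /=.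
- exact: tens_refl.
- exact: tens_sym.
- exact: tens_trans.
- by rewrite !map_cat; exact: tens_cat.
- by rewrite !map_cat; exact: tens_catC.
- by move=> *; rewrite mulrDr; exact: tens_addl.
- by move=> *; exact: tens_addr.
- by rewrite mulr0; exact: tens_zero.
- by move=> *; rewrite mulrA; exact: tens_balanced.
Qed.

Lemma Fpull_scaleE r l :
  Fpull_scale r (fsum l) = fsum [seq (r * x.1, x.2) | x <- l].
Proof. by apply/fsumP/tens_rel_scale; exact: repr_fsum. Qed.

Lemma Fpull_addA : associative Fpull_add.
Proof.
elim/fsum_ind=> a; elim/fsum_ind=> b; elim/fsum_ind=> c.
by rewrite !Fpull_addE catA.
Qed.

Lemma Fpull_addC : commutative Fpull_add.
Proof.
elim/fsum_ind=> a; elim/fsum_ind=> b; rewrite !Fpull_addE.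
by apply/fsumP; exact: tens_catC.
Qed.

Lemma Fpull_add0 : left_id (fsum [::]) Fpull_add.
Proof. by elim/fsum_ind=> a; rewrite !Fpull_addE. Qed.

Lemma Fpull_scale0 z : Fpull_scale 0 z = fsum [::].
Proof.
elim/fsum_ind: z => l; rewrite Fpull_scaleE; apply/fsumP.
elim: l => [|[r n] l ih] /=; first exact: tens_refl.
rewrite mul0r -[X in tens_rel _ X]/([::] ++ [::]) -cat1s.
by apply: tens_cat ih; exact: tens_zero.
Qed.

Lemma Fpull_scaleDl z r r' :
  Fpull_scale (r + r') z = Fpull_add (Fpull_scale r z) (Fpull_scale r' z).
Proof.
elim/fsum_ind: z => l; rewrite !Fpull_scaleE Fpull_addE; apply/fsumP.
elim: l => [|[a n] l ih] /=; first exact: tens_refl.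
rewrite mulrDl -cat1s.
apply: tens_trans (tens_cat (tens_addl _ _ _) ih) _ => /=.
rewrite -cat1s -[X in tens_rel _ X]cat1s; apply: tens_cat; first exact: tens_refl.
set u := (r' * a, n); set l1 := map _ l; set l2 := map _ l.
rewrite -[u :: l1 ++ l2]/((u :: l1) ++ l2) -cat_rcons.
apply: tens_cat; last exact: tens_refl.
by rewrite -cat1s -cats1; exact: tens_catC.
Qed.

Lemma Fpull_scaleDr r : {morph Fpull_scale r : z w / Fpull_add z w}.
Proof.
elim/fsum_ind=> a; elim/fsum_ind=> b.
by rewrite !(Fpull_scaleE, Fpull_addE) map_cat.
Qed.

Lemma Fpull_scale1 : left_id 1 Fpull_scale.
Proof.
elim/fsum_ind=> a; rewrite Fpull_scaleE; congr fsum.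
by rewrite -[RHS]map_id; apply: eq_map => -[r n] /=; rewrite mul1r.
Qed.

Lemma Fpull_scaleA r r' z :
  Fpull_scale r (Fpull_scale r' z) = Fpull_scale (r * r') z.
Proof.
elim/fsum_ind: z => l; rewrite !Fpull_scaleE -map_comp; congr fsum.
by apply: eq_map => x /=; rewrite mulrA.
Qed.

Lemma Fpull_addN : left_inverse (fsum [::]) (Fpull_scale (-1)) Fpull_add.
Proof.
by move=> z; rewrite -{2}[z]Fpull_scale1 -Fpull_scaleDl addNr Fpull_scale0.
Qed.

HB.instance Definition _ :=
  GRing.isZmodule.Build Fpull Fpull_addA Fpull_addC Fpull_add0 Fpull_addN.
HB.instance Definition _ :=
  GRing.Zmodule_isLmodule.Build R Fpull
    Fpull_scaleA Fpull_scale1 Fpull_scaleDr Fpull_scaleDl.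

Definition tens r n : Fpull := fsum [:: (r, n)].

Section Lift.
Variables (V : zmodType) (b : R -> N -> V).

Definition balanced : Prop :=
  [/\ forall r r' n, b (r + r') n = b r n + b r' n,
      forall r n n', b r (n + n') = b r n + b r n' &
      forall r a n, b (r * a ^+ (p ^ s)) n = b r (a *: n)].

(* The additive map [r (x) n |-> b r n]; meaningful when [b] is balanced
   (see [tliftE]). *)
Definition tlift (z : Fpull) : V := \sum_(x <- repr z) b x.1 x.2.

Hypothesis bb : balanced.

Lemma tlift_fsum l : tlift (fsum l) = \sum_(x <- l) b x.1 x.2.
Proof.
have [bDl bDr bZ] := bb.
suff h l1 l2 : tens_rel l1 l2 ->
    \sum_(x <- l1) b x.1 x.2 = \sum_(x <- l2) b x.1 x.2 by exact/h/repr_fsum.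
elim=> {l1 l2} //=.
- by move=> l1 l2 l3 _ -> _ ->.
- by move=> l1 l2 l3 l4 _ h1 _ h2; rewrite !big_cat /= h1 h2.
- by move=> l1 l2; rewrite !big_cat /= addrC.
- by move=> r r' n; rewrite !big_cons !big_nil /= !addr0 bDl.
- by move=> r n n'; rewrite !big_cons !big_nil /= !addr0 bDr.
- move=> n; rewrite big_seq1 big_nil /=.
  by apply: (addrI (b 0 n)); rewrite -bDl !addr0.
- by move=> r a n; rewrite !big_seq1 /= bZ.
Qed.

Lemma tliftE r n : tlift (tens r n) = b r n.
Proof. by rewrite tlift_fsum big_seq1. Qed.

Lemma tliftD z w : tlift (z + w) = tlift z + tlift w.
Proof.
elim/fsum_ind: z => l; elim/fsum_ind: w => l'.
by rewrite [_ + _]Fpull_addE !tlift_fsum big_cat.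
Qed.

End Lift.

Lemma tensDl r r' n : tens (r + r') n = tens r n + tens r' n.
Proof. by rewrite [RHS]Fpull_addE; apply/fsumP/tens_addl. Qed.

Lemma tensDr r n n' : tens r (n + n') = tens r n + tens r n'.
Proof. by rewrite [RHS]Fpull_addE; apply/fsumP/tens_addr. Qed.

Lemma tens_bal r a n : tens (r * a ^+ (p ^ s)) n = tens r (a *: n).
Proof. exact/fsumP/tens_balanced. Qed.

Lemma scale_tens a r n : a *: tens r n = tens (a * r) n.
Proof. exact: Fpull_scaleE. Qed.

Lemma Fpull_ind (P : Fpull -> Prop) : P 0 ->
  (forall r n z, P z -> P (tens r n + z)) -> forall z, P z.
Proof.
move=> P0 PS; elim/fsum_ind; elim=> // -[r n] l /(PS r n).
by rewrite [_ + _]Fpull_addE.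
Qed.

End Pullback.

Arguments Fpull p s {R} N.
Arguments tens p s {R N}.
Arguments tlift {p s R N V}.
Arguments balanced p s {R N V}.

Section RFModules.
Variables (p : nat) (R : comPzRingType) (N : lmodType R) (F : {additive N -> N}).

Definition RF_module : Prop := forall (r : R) (x : N), F (r *: x) = r ^+ p *: F x.

Definition RF_submodule (M : set N) : Prop :=
  submodule M /\ forall x : N, M x -> M (F x).

Definition RF_finitely_generated : Prop :=
  exists (t : nat) (g : 'I_t -> N), smallest RF_submodule (range g) = setT.

Definition thetaN : Fpull p 1 N -> N := tlift (fun r x => r *: F x).

Definition unit_RF_module : Prop := RF_module /\ bijective thetaN.

Definition thetaN_inv (x : N) : Fpull p 1 N := xget 0 [set z | thetaN z = x].

(* [F^{s*} f : F^{s*} M -> F^{s*} M']. *)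
Definition Fpull_map (s : nat) (M M' : lmodType R) (f : M -> M') :
  Fpull p s M -> Fpull p s M' := tlift (fun r x => tens p s r (f x)).

(* The canonical identification [F^{s*} (F^* N) = F^{(s+1)*} N],
   [r (x) (r' (x) x) |-> r r'^{p^s} (x) x]. *)
Definition Fpull_succ (s : nat) : Fpull p s (Fpull p 1 N) -> Fpull p s.+1 N :=
  tlift (fun r => tlift (fun r' x => tens p s.+1 (r * r' ^+ (p ^ s)) x)).

(* [theta_s = F^{(s-1)*}(theta_N^{-1}) o ... o theta_N^{-1} : N -> F^{s*} N];
   [theta_0] is the identification [N = F^{0*} N]. *)
Fixpoint theta (s : nat) : N -> Fpull p s N :=
  match s with
  | 0 => fun x => tens p 0 1 x
  | s'.+1 => fun x => Fpull_succ (Fpull_map thetaN_inv (theta s' x))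
  end.

Definition theta_inv (s : nat) (z : Fpull p s N) : N :=
  xget 0 [set x | theta s x = z].

(* [F^{s*} N0], as a submodule of [N]. *)
Definition Fpull_image (s : nat) (N0 : set N) : set N := submod_span (iter s F @` N0).

Definition is_root (N0 : set N) : Prop :=
  [/\ submodule N0, fg_submodule N0, N0 `<=` Fpull_image 1 N0 &
      \bigcup_s Fpull_image s N0 = setT].

End RFModules.

Section DiffOps.
Variables (p : nat) (R : comPzRingType).
Implicit Types (u : R -> R).

Fixpoint diffop (n : nat) u : Prop :=
  match n with
  | 0 => exists r : R, forall x : R, u x = r * x
  | n'.+1 => (forall x y : R, u (x + y) = u x + u y) /\
             forall r : R, diffop n' (fun x => u (r * x) - r * u x)
  end.

Definition D_R u : Prop := exists n : nat, diffop n u.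

(* [u] belongs to [End_{R^{p^s}}(R)]. *)
Definition End_pow (s : nat) u : Prop :=
  (forall x y : R, u (x + y) = u x + u y) /\
  (forall a x : R, u (a ^+ (p ^ s) * x) = a ^+ (p ^ s) * u x).

Variables (N : lmodType R) (F : {additive N -> N}).

(* [u (x) id_N]. *)
Definition Fpull_op (s : nat) u : Fpull p s N -> Fpull p s N :=
  tlift (fun r x => tens p s (u r) x).

Definition act_at (s : nat) u (x : N) : N :=
  theta_inv F (Fpull_op u (theta p F s x)).

(* [D_act] uses some [s] with [u \in End_{R^{p^s}}(R)]; such an [s] exists
   ([D_R_End_pow]) and its choice is irrelevant ([D_actE]). *)
Definition D_act u : N -> N := act_at (xget 0%N [set s | End_pow s u]) u.

Definition generates_D (t : nat) (g : 'I_t -> N) : Prop :=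
  forall x : N, exists u : 'I_t -> R -> R,
    (forall i, D_R (u i)) /\ x = \sum_i D_act (u i) (g i).

End DiffOps.

Lemma additive0 (U V : zmodType) (f : U -> V) :
  (forall x y, f (x + y) = f x + f y) -> f 0 = 0.
Proof. by move=> fD; apply: (addrI (f 0)); rewrite -fD !addr0. Qed.

Section Coherence.
Variables (p : nat) (R : comPzRingType).
Hypotheses (pp : prime p) (pR : p%:R = 0 :> R).

Lemma exprDp (x y : R) : (x + y) ^+ p = x ^+ p + y ^+ p.
Proof.
have p0 := prime_gt0 pp.
rewrite exprDn -(prednK p0) big_ord_recr big_ord_recl /= (prednK p0).
rewrite !subn0 !subnn !bin0 !binn !expr0 !mulr1 !mul1r !mulr1n.
rewrite big1 ?addr0 // => i _.
have /dvdnP[k ->] : (p %| 'C(p, bump 0 i))%N.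
  by apply: prime_dvd_bin => //=; rewrite /bump /= add1n -ltn_predRL ltn_ord.
by rewrite -mulr_natr natrM pR !mulr0.
Qed.

Lemma exprDpX s (x y : R) : (x + y) ^+ (p ^ s) = x ^+ (p ^ s) + y ^+ (p ^ s).
Proof. by elim: s => [//|s ih]; rewrite expnSr !exprM ih exprDp. Qed.

Lemma diffop_add n (u : R -> R) : diffop n u ->
  forall x y, u (x + y) = u x + u y.
Proof.
case: n => [[r ur] x y|n []//]; first by rewrite !ur mulrDr.
Qed.

Lemma diffop_End_pow n (u : R -> R) : diffop n u -> End_pow p n u.
Proof.
move=> h; split; first exact: diffop_add h.
elim: n u h => [u [r ur] a x|n ih u [_ h] a x]; first by rewrite !ur mulrCA.
set t := a ^+ (p ^ n); pose e y := u (t * y) - t * u y.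
have et y : e (t * y) = t * e y by apply: ih; exact: h.
have ue y : u (t * y) = t * u y + e y by rewrite /e addrC subrK.
have ek k y : u (t ^+ k * y) = t ^+ k * u y + k%:R * (t ^+ k.-1 * e y).
  elim: k y => [|k ihk] y; first by rewrite !expr0 !mul1r mul0r addr0.
  rewrite exprSr -mulrA ihk ue et /= mulrDr mulrA -exprSr -addrA; congr (_ + _).
  case: k {ihk} => [|k]; first by rewrite ?expr0 ?mul0r ?mul1r ?addr0.
  have -> : t ^+ k * (t * e y) = t ^+ k.+1 * e y by rewrite exprSr mulrA.
  by rewrite [in RHS]mulrS mulrDl mul1r.
by rewrite expnSr exprM -/t ek pR mul0r addr0.
Qed.

Lemma D_R_End_pow (u : R -> R) : D_R u -> exists s, End_pow p s u.
Proof. by move=> [n /diffop_End_pow]; exists n. Qed.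

Variables (N : lmodType R) (F : {additive N -> N}).
Hypothesis uF : unit_RF_module p F.

Lemma thetaN_balanced : balanced p 1 (fun r x => r *: F x).
Proof.
have [hF _] := uF; split=> [r r' x|r x y|r a x].
- exact: scalerDl.
- by rewrite raddfD scalerDr.
- by rewrite hF scalerA.
Qed.

Lemma thetaNE r x : thetaN F (tens p 1 r x) = r *: F x.
Proof. exact: tliftE thetaN_balanced _ _. Qed.

Lemma thetaND (z w : Fpull p 1 N) : thetaN F (z + w) = thetaN F z + thetaN F w.
Proof. exact: (@tliftD p 1 _ _ _ _ thetaN_balanced). Qed.

Lemma thetaN0 : thetaN F (0 : Fpull p 1 N) = 0.
Proof. exact: (additive0 thetaND). Qed.

Lemma thetaNZ r (z : Fpull p 1 N) : thetaN F (r *: z) = r *: thetaN F z.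
Proof.
elim/Fpull_ind: z => [|a x z ih]; first by rewrite scaler0 thetaN0 scaler0.
by rewrite scalerDr !thetaND ih scale_tens !thetaNE scalerDr scalerA.
Qed.

Lemma thetaN_invK x : thetaN F (thetaN_inv p F x) = x.
Proof.
have [_ [g _ gK]] := uF.
by rewrite /thetaN_inv; case: xgetP => [z _ //|/(_ (g x))[]]; exact: gK.
Qed.

Lemma thetaNK : cancel (@thetaN p _ _ F) (thetaN_inv p F).
Proof. by move=> z; apply: (bij_inj uF.2); rewrite thetaN_invK. Qed.

Lemma thetaN_invD x y :
  thetaN_inv p F (x + y) = thetaN_inv p F x + thetaN_inv p F y.
Proof. by apply: (bij_inj uF.2); rewrite thetaND !thetaN_invK. Qed.

Lemma thetaN_invZ r x : thetaN_inv p F (r *: x) = r *: thetaN_inv p F x.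
Proof. by apply: (bij_inj uF.2); rewrite thetaNZ !thetaN_invK. Qed.

Section Map.
Variables (s : nat) (M M' : lmodType R) (f : M -> M').
Hypotheses (fD : forall x y, f (x + y) = f x + f y)
           (fZ : forall r x, f (r *: x) = r *: f x).

Lemma Fpull_map_balanced : balanced p s (fun r x => tens p s r (f x)).
Proof.
split=> *; first by rewrite tensDl.
- by rewrite fD tensDr.
- by rewrite fZ tens_bal.
Qed.

Lemma Fpull_mapE r x : Fpull_map f (tens p s r x) = tens p s r (f x).
Proof. exact: tliftE Fpull_map_balanced _ _. Qed.

Lemma Fpull_mapD z w :
  Fpull_map f (z + w : Fpull p s M) = Fpull_map f z + Fpull_map f w.
Proof. exact: (tliftD Fpull_map_balanced). Qed.

Lemma Fpull_map0 : Fpull_map f (0 : Fpull p s M) = 0.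
Proof. exact: (additive0 Fpull_mapD). Qed.

End Map.

Lemma Fpull_succ_in s r :
  balanced p 1 (fun r' (x : N) => tens p s.+1 (r * r' ^+ (p ^ s)) x).
Proof.
split=> *; first by rewrite exprDpX mulrDr tensDl.
- by rewrite tensDr.
- by rewrite exprMn -exprM -expnD mulrA tens_bal.
Qed.

Lemma Fpull_succ_balanced s :
  balanced p s (fun r : R => tlift (p := p) (s := 1)
    (fun r' (x : N) => tens p s.+1 (r * r' ^+ (p ^ s)) x)).
Proof.
split=> [r r' z|r z w|r a z].
- elim/Fpull_ind: z => [|b x z ih].
    have t0 c : tlift (p := p) (s := 1)
        (fun r' (x : N) => tens p s.+1 (c * r' ^+ (p ^ s)) x) 0 = 0.
      exact: (additive0 (tliftD (Fpull_succ_in s c))).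
    by rewrite !t0 addr0.
  rewrite !(tliftD (Fpull_succ_in s _)) ih !(tliftE (Fpull_succ_in s _)).
  by rewrite mulrDl tensDl addrACA.
- exact: (tliftD (Fpull_succ_in s _)).
- elim/Fpull_ind: z => [|b x z ih].
    have t0 c : tlift (p := p) (s := 1)
        (fun r' (x : N) => tens p s.+1 (c * r' ^+ (p ^ s)) x) 0 = 0.
      exact: (additive0 (tliftD (Fpull_succ_in s c))).
    by rewrite scaler0 !t0.
  rewrite scalerDr !(tliftD (Fpull_succ_in s _)) ih scale_tens.
  by rewrite !(tliftE (Fpull_succ_in s _)) exprMn mulrA.
Qed.

Lemma Fpull_succE s r r' (x : N) :
  Fpull_succ (tens p s r (tens p 1 r' x)) = tens p s.+1 (r * r' ^+ (p ^ s)) x.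
Proof.
by rewrite /Fpull_succ (tliftE (Fpull_succ_balanced s)) (tliftE (Fpull_succ_in s _)).
Qed.

Lemma Fpull_succD s (z w : Fpull p s (Fpull p 1 N)) :
  Fpull_succ (z + w) = Fpull_succ z + Fpull_succ w.
Proof. exact: (tliftD (Fpull_succ_balanced s)). Qed.

Lemma Fpull_succ0 s : Fpull_succ (0 : Fpull p s (Fpull p 1 N)) = 0.
Proof. exact: (additive0 (@Fpull_succD s)). Qed.

(* [theta_s^{-1}] is [r (x) x |-> r F^s x]. *)
Definition Fmu s : Fpull p s N -> N := tlift (fun r x => r *: iter s F x).

Lemma iterFD s x y : iter s F (x + y) = iter s F x + iter s F y.
Proof. by elim: s => //= s ->; rewrite raddfD. Qed.

Lemma iterFZ s r x : iter s F (r *: x) = r ^+ (p ^ s) *: iter s F x.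
Proof. by elim: s => [//|s /= ->]; rewrite uF.1 -exprM -expnSr. Qed.

Lemma mu_balanced s : balanced p s (fun r x => r *: iter s F x).
Proof.
split=> [r r' x|r x y|r a x].
- exact: scalerDl.
- by rewrite iterFD scalerDr.
- by rewrite iterFZ scalerA.
Qed.

Lemma muE s r x : Fmu (tens p s r x) = r *: iter s F x.
Proof. exact: (tliftE (mu_balanced s)). Qed.

Lemma muD s (z w : Fpull p s N) : Fmu (z + w) = Fmu z + Fmu w.
Proof. exact: (tliftD (mu_balanced s)). Qed.

Lemma mu0 s : Fmu (0 : Fpull p s N) = 0.
Proof. exact: (additive0 (@muD s)). Qed.

Definition theta_step s (z : Fpull p s N) : Fpull p s.+1 N :=
  Fpull_succ (Fpull_map (thetaN_inv p F) z).

Lemma stepD s (z w : Fpull p s N) : theta_step (z + w) = theta_step z + theta_step w.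
Proof. by rewrite /theta_step (Fpull_mapD thetaN_invD thetaN_invZ) Fpull_succD. Qed.

Lemma step0 s : theta_step (0 : Fpull p s N) = 0.
Proof. exact: (additive0 (@stepD s)). Qed.

Lemma step_tens s r x :
  theta_step (tens p s r x) = Fpull_succ (tens p s r (thetaN_inv p F x)).
Proof. by rewrite /theta_step (Fpull_mapE s thetaN_invD thetaN_invZ). Qed.

Lemma tens0r s (M : lmodType R) r : tens p s r (0 : M) = 0.
Proof. exact: (additive0 (@tensDr p s R M r)). Qed.

Lemma mu_step s (z : Fpull p s N) : Fmu (theta_step z) = Fmu z.
Proof.
elim/Fpull_ind: z => [|r x z ih]; first by rewrite step0 !mu0.
rewrite stepD !muD ih; congr (_ + _); rewrite step_tens muE.
rewrite -[in RHS](thetaN_invK x); elim/Fpull_ind: (thetaN_inv p F x) => [|r' y w].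
  by rewrite tens0r Fpull_succ0 mu0 thetaN0 -[X in iter s F X](scale0r 0)
             iterFZ expr0n expn_eq0 -leqn0 leqNgt prime_gt0 //= scale0r scaler0.
rewrite tensDr Fpull_succD muD => ->.
rewrite thetaND iterFD scalerDr Fpull_succE muE; congr (_ + _).
by rewrite thetaNE iterFZ scalerA -iterSr.
Qed.

Lemma mu_theta s x : Fmu (theta p F s x) = x.
Proof. by elim: s => [|s ih]; rewrite ?muE ?scale1r // [LHS]mu_step. Qed.

Lemma step_surj s (z : Fpull p s.+1 N) : exists w : Fpull p s N, theta_step w = z.
Proof.
elim/Fpull_ind: z => [|r x z [w <-]]; first by exists 0; exact: step0.
exists (tens p s r (F x) + w); rewrite stepD step_tens; congr (_ + _).
have -> : thetaN_inv p F (F x) = tens p 1 1 x.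
  by rewrite -[LHS]thetaNK thetaN_invK -[F x]scale1r -thetaNE thetaNK.
by rewrite Fpull_succE expr1n mulr1.
Qed.

Lemma theta_surj s (z : Fpull p s N) : exists x, theta p F s x = z.
Proof.
elim: s z => [|s ih] z; last first.
  by have [w <-] := step_surj z; have [x <-] := ih w; exists x.
elim/Fpull_ind: z => [|r x z [y /= <-]]; first by exists 0; rewrite /= tens0r.
by exists (r *: x + y); rewrite /= tensDr -tens_bal expn0 expr1 mul1r.
Qed.

Lemma theta_bij s : bijective (theta p F s).
Proof.
exists (@Fmu s) => [x|z]; first exact: mu_theta.
by have [x <-] := theta_surj z; rewrite mu_theta.
Qed.

Lemma theta_invE s (z : Fpull p s N) : theta_inv F z = Fmu z.
Proof.
rewrite /theta_inv; case: xgetP => [x _ <-|h]; first by rewrite mu_theta.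
by have [x /h] := theta_surj z.
Qed.

Lemma op_balanced s (u : R -> R) : End_pow p s u ->
  balanced p s (fun r (x : N) => tens p s (u r) x).
Proof.
move=> [uD uZ]; split=> *; first by rewrite uD tensDl.
- by rewrite tensDr.
- by rewrite mulrC uZ mulrC tens_bal.
Qed.

Lemma End_powS s (u : R -> R) : End_pow p s u -> End_pow p s.+1 u.
Proof. by move=> [uD uZ]; split=> // a x; rewrite expnS exprM uZ. Qed.

Lemma op_step s (u : R -> R) (z : Fpull p s N) : End_pow p s u ->
  Fpull_op u (theta_step z) = theta_step (Fpull_op u z).
Proof.
move=> hu; have hs := op_balanced hu; have hs1 := op_balanced (End_powS hu).
have op0 : Fpull_op u (0 : Fpull p s N) = 0.
  exact: (additive0 (tliftD hs)).
have op0S : Fpull_op u (0 : Fpull p s.+1 N) = 0.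
  exact: (additive0 (tliftD hs1)).
elim/Fpull_ind: z => [|r x z ih]; first by rewrite step0 op0 step0 op0S.
rewrite stepD [LHS](tliftD hs1) -/(Fpull_op u _) -/(Fpull_op u _) ih.
rewrite [Fpull_op u (_ + z)](tliftD hs) stepD; congr (_ + _).
rewrite (tliftE hs) !step_tens.
elim/Fpull_ind: (thetaN_inv p F x) => [|r' y w ihw].
  by rewrite !tens0r !Fpull_succ0 op0S.
rewrite !tensDr !Fpull_succD [LHS](tliftD hs1) [X in _ + X]ihw; congr (_ + _).
by rewrite !Fpull_succE (tliftE hs1) mulrC hu.2 mulrC.
Qed.

Lemma act_atS s (u : R -> R) x : End_pow p s u ->
  act_at p F s.+1 u x = act_at p F s u x.
Proof.
move=> hu; rewrite /act_at !theta_invE -/(theta_step (theta p F s x)).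
by rewrite op_step // mu_step.
Qed.

Lemma D_actE s (u : R -> R) x : End_pow p s u -> D_act p F u x = act_at p F s u x.
Proof.
move=> hu; rewrite /D_act; case: xgetP => [s' _ /= hu'|/(_ s)//].
have act_le a b : (a <= b)%N -> End_pow p a u ->
    End_pow p b u /\ act_at p F b u x = act_at p F a u x.
  move=> + ha; elim: b => [|b ih]; first by rewrite leqn0 => /eqP <-.
  rewrite leq_eqVlt => /orP[/eqP <- //|/ih[hb <-]].
  by split; [exact: End_powS | exact: act_atS].
by have [/act_le/(_ hu)[]|/ltnW/act_le/(_ hu')[]] := leqP s s'.
Qed.

End Coherence.

(* Main.v *)
(* Write [f_N] for the map [N -> N], [r F^s(y) |-> f(r) y], induced by a
   [p^-s]-linear map [f : R -> R], and put [C(M) = \sum_f R f_N(M)] over all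
   [p^-1]-linear [f].  Since [N0 <= F^* N0], the submodules [C^s(N0)] of [N0]
   decrease.  They stabilise by Gabber's argument for Cartier modules: at a
   minimal prime of the stable annihilator of the successive quotients, the
   chain lives in a module of finite length.  By Kunz's theorem, [R] is a
   projective module over itself through Frobenius, and a dual basis
   [r = \sum_i f_i(r)^p e_i] gives [M <= F^* C(M)]; hence every [x] in [N] lies
   in [F^{s*} C^s(N0)] for a large [s], i.e. is a sum of terms
   [r F^s(f_N(n_i))] with [f] [p^-s]-linear.  Such a term is [u n_i] with
   [u(a) = r f(a)^{p^s}], which is [R^{p^s}]-linear and therefore a differential
   operator, because [R] is finite over [R^{p^s}] and [ad(b)^{p^s} =
   ad(b^{p^s})] in characteristic [p].

   Kunz's theorem is proved for a regular local ring from the fact that a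
   system of parameters generating the maximal ideal is a regular sequence in
   every order, which itself comes from Krull's principal ideal theorem; it is
   then globalised by clearing denominators.  Quotients and localizations are
   avoided: one works with ideals containing a given ideal, and with
   submodules saturated with respect to the complement of a prime. *)
Require Import Defs.
From HB Require Import structures.
From mathcomp Require Import all_boot all_algebra.
From mathcomp Require Import ring.
From mathcomp Require Import boolp classical_sets.

Set Implicit Arguments.
Unset Strict Implicit.
Unset Printing Implicit Defensive.

Import GRing.Theory.
Local Open Scope classical_set_scope.
Local Open Scope ring_scope.

(** * Finitely generated modules over noetherian rings *)

Section Modules.
Variables (R : comPzRingType) (V : lmodType R).
Implicit Types (L M W : set V) (T : set R) (l : seq V).

Lemma submodD M x y : submodule M -> M x -> M y -> M (x + y).
Proof. by move=> [_ h] mx my; rewrite -[x]scale1r; exact: h. Qed.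

Lemma submodZ M a x : submodule M -> M x -> M (a *: x).
Proof. by move=> [h0 h] mx; rewrite -[_ *: _]addr0; exact: h. Qed.

Lemma submodN M x : submodule M -> M x -> M (- x).
Proof. by rewrite -scaleN1r; exact: submodZ. Qed.

Lemma submodB M x y : submodule M -> M x -> M y -> M (x - y).
Proof. by move=> hM mx my; apply: submodD => //; exact: submodN. Qed.

Lemma submod_sum (I : Type) (s : seq I) (P : pred I) (f : I -> V) M :
  submodule M -> (forall i, P i -> M (f i)) -> M (\sum_(i <- s | P i) f i).
Proof.
move=> hM hf; elim/big_ind: _ => //; first exact: hM.1.
by move=> x y; exact: submodD.
Qed.

Lemma submodI L M : submodule L -> submodule M -> submodule (L `&` M).
Proof.
move=> hL hM; split; first by split; [exact: hL.1|exact: hM.1].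
by move=> a x y [? ?] [? ?]; split; [exact: hL.2|exact: hM.2].
Qed.

Definition addset L M : set V := [set v | exists2 x, L x & M (v - x)].

Lemma submod_addset L M : submodule L -> submodule M -> submodule (addset L M).
Proof.
move=> hL hM; split; first by exists 0; rewrite ?subr0; [exact: hL.1|exact: hM.1].
move=> a x y [x' Lx Mx] [y' Ly My]; exists (a *: x' + y'); first exact: hL.2.
have -> : a *: x + y - (a *: x' + y') = a *: (x - x') + (y - y').
  by rewrite scalerBr opprD addrACA.
exact: hM.2.
Qed.

Lemma addsetl L M : submodule M -> L `<=` addset L M.
Proof. by move=> hM x Lx; exists x => //; rewrite subrr; exact: hM.1. Qed.

Lemma addsetr L M : submodule L -> M `<=` addset L M.
Proof. by move=> hL x Mx; exists 0; [exact: hL.1|rewrite subr0]. Qed.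

Lemma addset_min L M W : submodule W -> L `<=` W -> M `<=` W -> addset L M `<=` W.
Proof.
move=> hW lw mw x [y Ly Mxy]; rewrite -[x](subrK y).
by apply: submodD => //; [exact: mw|exact: lw].
Qed.

Lemma submod_span_sub (X : set V) : submodule (submod_span X).
Proof.
split=> [A [[]] //|a x y hx hy A hA].
by apply: hA.1.2; [exact: hx|exact: hy].
Qed.

Lemma submod_span_in (X : set V) : X `<=` submod_span X.
Proof. by move=> x Xx A [_]; exact. Qed.

Lemma submod_span_min (X : set V) M : submodule M -> X `<=` M -> submod_span X `<=` M.
Proof. by move=> hM XM x; apply. Qed.

(** Coefficients are confined to [T], so that for an ideal [T] this is the product of [T] with the
    module spanned by [l], the form that Nakayama's lemma needs. *)
Fixpoint lspan T l : set V :=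
  match l with
  | [::] => [set 0]
  | g :: l' => [set v | exists r w, [/\ T r, lspan T l' w & v = r *: g + w]]
  end.

Lemma lspan_sub T l : @submodule R R^o T -> submodule (lspan T l).
Proof.
move=> hT; elim: l => [|g l [h0 ih]] /=.
  by split=> // a x y -> ->; rewrite scaler0 addr0.
split; first by exists 0, 0; rewrite scale0r addr0; split=> //; exact: hT.1.
move=> a _ _ [r [w [Tr lw ->]]] [r' [w' [Tr' lw' ->]]].
exists (a * r + r'), (a *: w + w'); split=> //; [exact: (hT.2)|exact: ih|].
by rewrite scalerDr scalerA scalerDl addrACA.
Qed.

Lemma submodT : submodule (setT : set V). Proof. by []. Qed.

Lemma lspan_in T l r x : @submodule R R^o T -> T r -> x \in l -> lspan T l (r *: x).
Proof.
move=> hT Tr; elim: l => [//|g l ih]; rewrite inE => /orP[/eqP ->|xl] /=.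
  by exists r, 0; rewrite addr0; split=> //; exact: (lspan_sub l hT).1.
by exists 0, (r *: x); rewrite scale0r add0r; split=> //; [exact: hT.1|exact: ih].
Qed.

Lemma lspan_min T l M : submodule M ->
  (forall r x, T r -> x \in l -> M (r *: x)) -> lspan T l `<=` M.
Proof.
move=> hM; elim: l => [|g l ih] h x /=; first by move=> ->; exact: hM.1.
move=> [r [w [Tr lw ->]]]; apply: submodD => //.
  by apply: h => //; rewrite inE eqxx.
by apply: ih lw => r' x' Tr' x'l; apply: h => //; rewrite inE x'l orbT.
Qed.

Lemma lspan_cat T l1 l2 x y : lspan T l1 x -> lspan T l2 y -> lspan T (l1 ++ l2) (x + y).
Proof.
elim: l1 x => [|g l1 ih] x /=; first by move=> ->; rewrite add0r.
move=> [r [w [Tr lw ->]]] ly; exists r, (w + y).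
by rewrite addrA; split=> //; exact: ih.
Qed.

Definition noeth M : Prop :=
  forall L, submodule L -> L `<=` M -> exists l : seq V, L = lspan setT l.

Lemma lspan_setT_sub l : submodule (lspan setT l).
Proof. exact: (lspan_sub l). Qed.

Lemma lspan_mem l x : x \in l -> lspan setT l x.
Proof. by move=> xl; rewrite -[x]scale1r; apply: lspan_in. Qed.

Lemma lspan_subset l M : submodule M -> (forall x, x \in l -> M x) -> lspan setT l `<=` M.
Proof. by move=> hM h; apply: lspan_min => // r x _ xl; apply: submodZ => //; exact: h. Qed.

Lemma noethW M M' : M' `<=` M -> noeth M -> noeth M'.
Proof. by move=> h hM L hL LM; apply: hM => // x /LM /h. Qed.

(** The union of a chain is finitely generated and its generators all lie in one member, which
    therefore is the union; Zorn's lemma applies. *)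
Lemma noeth_max M (P : set (set V)) : noeth M ->
  (forall L, P L -> submodule L /\ L `<=` M) -> (exists L, P L) ->
  exists L, P L /\ forall L', P L' -> L `<=` L' -> L' = L.
Proof.
move=> hM hP [L0 PL0].
pose Q := fun A : set V => P A \/ A = set0.
have [F FQ Ftot|A [[PA|A0] Amax]] := @Zorn_bigcup V Q; last 1 first.
- exfalso; apply: (Amax L0); last by left.
  rewrite A0; split=> [x []|/(_ 0 (hP _ PL0).1.1)//].
- have [[X FX [x Xx]]|h] := pselect (exists2 X, F X & exists x, X x); last first.
    right; rewrite -subset0 => x [X FX Xx]; case: h; exists X => //.
    by exists x.
  have FP Y y : F Y -> Y y -> P Y by move=> /FQ[//|->].
  have PX := FP _ _ FX Xx.
  set U := \bigcup_(X in F) X.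
  have XU : X `<=` U by move=> y Xy; exists X.
  have hU : submodule U.
    split; first by apply: XU; exact: (hP _ PX).1.1.
    move=> a y z [Y FY Yy] [Z FZ Zz].
    have hY := (hP _ (FP _ _ FY Yy)).1; have hZ := (hP _ (FP _ _ FZ Zz)).1.
    have [YZ|ZY] := Ftot _ _ FY FZ.
      by exists Z => //; apply: hZ.2 => //; exact: YZ.
    by exists Y => //; apply: hY.2 => //; exact: ZY.
  have UM : U `<=` M by move=> y [Y FY Yy]; apply: (hP _ (FP _ _ FY Yy)).2.
  have [l Ul] := hM _ hU UM.
  suff [Y [FY XY lY]] : exists Y, [/\ F Y, X `<=` Y & forall y, y \in l -> Y y].
    have PY := FP _ _ FY (XY _ Xx).
    left; suff -> : U = Y by [].
    apply/seteqP; split=> [|y Yy]; last by exists Y.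
    by rewrite Ul; apply: lspan_subset lY; exact: (hP _ PY).1.
  have : forall y, y \in l -> U y by move=> y yl; rewrite Ul; exact: lspan_mem.
  elim: l {Ul} => [_|g l ih lU]; first by exists X; split=> [//|y //|y].
  have [|Y [FY XY lY]] := ih; first by move=> y yl; apply: lU; rewrite inE yl orbT.
  have [Z FZ Zg] := lU g (mem_head _ _).
  have [YZ|ZY] := Ftot _ _ FY FZ.
    exists Z; split=> // [y /XY /YZ //|y]; rewrite inE => /orP[/eqP -> //|/lY /YZ //].
  by exists Y; split=> // y; rewrite inE => /orP[/eqP -> //|/lY //]; exact: ZY.
- exists A; split=> // L PL AL; apply/seteqP; split=> //.
  by apply: contrapT => LA; apply: (Amax L) => //; left.
Qed.

Lemma noeth_ind M (P : set V -> Prop) : noeth M ->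
  (forall L, submodule L -> L `<=` M ->
     (forall L', submodule L' -> L' `<=` M -> L `<=` L' -> L' <> L -> P L') -> P L) ->
  forall L, submodule L -> L `<=` M -> P L.
Proof.
move=> hM ih L0 hL0 L0M; apply: contrapT => nP.
have [|| L [[hL LM nPL] Lmax]] := @noeth_max M
  (fun L => [/\ submodule L, L `<=` M & ~ P L]) hM.
- by move=> L [].
- by exists L0.
apply: nPL; apply: ih => // L' hL' L'M LL' neq; apply: contrapT => nPL'.
by apply: neq; exact: Lmax.
Qed.

Lemma noeth_stable M (L : nat -> set V) : noeth M ->
  (forall a, submodule (L a)) -> (forall a, L a `<=` M) ->
  (forall a, L a `<=` L a.+1) ->
  exists a, forall b, (a <= b)%N -> L b = L a.
Proof.
move=> hM hL LM mono.
have [||A [[a _ <-] Amax]] := @noeth_max M (range L) hM.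
- by move=> _ [a _ <-].
- by exists (L 0%N), 0%N.
exists a => b ab; apply: Amax; first by exists b.
elim: b ab => [|b ih]; first by rewrite leqn0 => /eqP ->.
by rewrite leq_eqVlt => /orP[/eqP -> //|/ih] h x /h; exact: mono.
Qed.

End Modules.

(** * Submodules of finitely generated modules over a noetherian ring *)

Section FiniteModules.
Variables (R : comPzRingType) (V : lmodType R).
Hypothesis nR : noetherian R.

Lemma fg_lspan (W : lmodType R) (M : set W) :
  fg_submodule M -> exists l : seq W, M = lspan setT l.
Proof.
move=> [t [g ->]]; exists (codom g); apply/seteqP; split.
  apply: submod_span_min; first exact: lspan_setT_sub.
  by move=> _ [i _ <-]; apply: lspan_mem; exact: codom_f.
apply: lspan_subset; first exact: submod_span_sub.
by move=> x /codomP[i ->]; apply: submod_span_in; exists i.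
Qed.

Lemma noeth_ring : @noeth R R^o setT.
Proof. by move=> I hI _; apply: fg_lspan; exact: nR. Qed.

(** The coefficients at [g] of the elements of [M] form an ideal. Lifts [gs] of its generators,
    together with generators [ls] of the part of [M] in the span of [l], generate [M]. *)
Lemma noeth_lspan (l : seq V) : noeth (lspan setT l).
Proof.
elim: l => [|g l ih] M hM Ml.
  exists [::]; apply/seteqP; split=> // x /= ->; exact: hM.1.
pose I := [set r : R^o | exists2 w, lspan setT l w & M (r *: g + w)].
have hI : submodule I.
  split; first by exists 0; rewrite ?scale0r ?addr0; [exact: (lspan_setT_sub l).1|exact: hM.1].
  move=> a x y [w lw xw] [w' lw' yw']; exists (a *: w + w').
    exact: (lspan_setT_sub l).2.
  have -> : (a *: x + y) *: g + (a *: w + w') = a *: (x *: g + w) + (y *: g + w').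
    by rewrite scalerDr scalerDl addrACA scalerA.
  exact: hM.2.
have [//|rs Irs] := noeth_ring hI.
have [||ls Mls] := ih (M `&` lspan setT l).
- exact/submodI/lspan_setT_sub.
- by move=> x [].
have [gs [gsM gsE]] : exists gs : seq V, (forall x, x \in gs -> M x) /\
    forall r : R^o, lspan setT rs r ->
    exists2 w, lspan setT l w & lspan setT gs (r *: g + w).
  have : forall r, r \in rs -> I r by move=> r; rewrite Irs; exact: lspan_mem.
  elim: rs {Irs} => [_|r rs ihr Irs].
    exists [::]; split=> // r /= ->; exists 0; first exact: (lspan_setT_sub l).1.
    by rewrite scale0r addr0.
  have [|gs [gsM gsE]] := ihr.
    by move=> r' hr'; apply: Irs; rewrite inE hr' orbT.
  have [w lw Mw] := Irs r (mem_head _ _).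
  exists (r *: g + w :: gs); split.
    by move=> x; rewrite inE => /orP[/eqP -> //|/gsM].
  move=> _ [a [r' [_ /gsE[w' lw' gw'] ->]]].
  exists (a *: w + w'); first exact: (lspan_setT_sub l).2.
  exists a, (r' *: g + w'); split=> //.
  by rewrite scalerDr scalerDl addrACA scalerA.
exists (gs ++ ls); apply/seteqP; split; last first.
  apply: lspan_subset => // x; rewrite mem_cat => /orP[/gsM //|].
  by move=> /(@lspan_mem R V); rewrite -Mls => -[].
move=> x Mx; have /= [r [w [_ lw xE]]] := Ml _ Mx.
have [|w' lw' gw'] := gsE r; first by rewrite -Irs; exists w; rewrite -?xE.
rewrite -[x](addrNK (r *: g + w')) addrC; apply: lspan_cat => //.
rewrite -Mls; split; last first.
  rewrite xE opprD addrACA subrr add0r.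
  by apply: submodB lw lw'; exact: lspan_setT_sub.
by apply: submodB => //; move: gw'; apply: lspan_subset.
Qed.

Lemma noeth_fg (M : set V) : fg_submodule M -> noeth M.
Proof. by move=> /fg_lspan[l ->]; exact: noeth_lspan. Qed.

End FiniteModules.

(** * Saturation at a prime and Nakayama's lemma *)

Section Saturation.
Variables (R : comPzRingType) (V : lmodType R).
Implicit Types (L M W : set V) (T : set R) (l : seq V).

Lemma ideal0 (I : set R) : ideal I -> I 0. Proof. by case. Qed.
Lemma idealD (I : set R) x y : ideal I -> I x -> I y -> I (x + y).
Proof. exact: (@submodD R R^o). Qed.
Lemma idealB (I : set R) x y : ideal I -> I x -> I y -> I (x - y).
Proof. exact: (@submodB R R^o). Qed.
Lemma idealM (I : set R) a x : ideal I -> I x -> I (a * x).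
Proof. exact: (@submodZ R R^o). Qed.
Lemma ideal_mulr (I : set R) a x : ideal I -> I x -> I (x * a).
Proof. by rewrite mulrC; exact: idealM. Qed.

Lemma prime_notM T x y : prime_ideal T -> ~ T x -> ~ T y -> ~ T (x * y).
Proof. by move=> [_ _ h] nx ny /h[]. Qed.

Lemma prime_exp T x k : prime_ideal T -> T (x ^+ k) -> T x.
Proof.
move=> [_ T1 h]; elim: k => [|k ih]; first by rewrite expr0 => /T1.
by rewrite exprS => /h[].
Qed.

(* The preimage in [V] of the localization of [L] at the prime [T]. *)
Definition sat T L : set V := [set v | exists2 s, ~ T s & L (s *: v)].

Lemma sat_submod T L : prime_ideal T -> submodule L -> submodule (sat T L).
Proof.
move=> pT hL; split; first by exists 1; [case: pT|rewrite scale1r; exact: hL.1].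
move=> a x y [s Ts Lx] [s' Ts' Ly]; exists (s * s'); first exact: prime_notM.
rewrite scalerDr; apply: submodD => //.
  by rewrite scalerA -mulrA mulrC -mulrA -!scalerA; do 2! apply: (submodZ _ hL).
by rewrite -scalerA; exact: submodZ.
Qed.

Lemma sat_sub T L : prime_ideal T -> L `<=` sat T L.
Proof. by move=> [_ T1 _] x Lx; exists 1; rewrite ?scale1r. Qed.

Lemma satS T L M : L `<=` M -> sat T L `<=` sat T M.
Proof. by move=> h x [s Ts /h ?]; exists s. Qed.

Lemma sat_id T L : prime_ideal T -> sat T (sat T L) = sat T L.
Proof.
move=> pT; apply/seteqP; split; last exact: sat_sub.
move=> x [s Ts [s' Ts' Lx]]; exists (s' * s); first exact: prime_notM.
by rewrite -scalerA.
Qed.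

Lemma sat_fg T L l : prime_ideal T -> submodule L ->
  (forall x, x \in l -> sat T L x) ->
  exists2 s, ~ T s & forall x, lspan setT l x -> L (s *: x).
Proof.
move=> pT hL; elim: l => [_|g l ih h].
  by exists 1 => [|x /= ->]; [case: pT|rewrite scaler0; exact: hL.1].
have [x xl|s Ts sl] := ih; first by apply: h; rewrite inE xl orbT.
have [s' Ts' Ls'] := h g (mem_head _ _).
exists (s * s') => [|_ [r [w [_ lw ->]]]]; first exact: prime_notM.
rewrite scalerDr; apply: submodD => //.
  by rewrite scalerA -mulrA [s' * r]mulrC mulrA -scalerA; exact: submodZ.
by rewrite mulrC -scalerA; apply: submodZ => //; exact: sl.
Qed.

(** Generators are eliminated one at a time: moving [r *: g] to the left leaves the coefficient
    [s - r], which is outside [T], so [g] can be solved for after saturation. *)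
Lemma local_nakayama T L l : prime_ideal T -> submodule L ->
  (forall x, x \in l -> exists2 s, ~ T s & addset L (lspan T l) (s *: x)) ->
  forall x, x \in l -> sat T L x.
Proof.
move=> pT hL; have hT : ideal T by case: pT.
elim: l => [//|g l ih] h.
have hA : submodule (addset L (lspan T l)) by apply/submod_addset/lspan_sub.
have [s Ts [v Lv [r [w [Tr lw e]]]]] := h g (mem_head _ _).
have key : addset L (lspan T l) ((s - r) *: g).
  exists v => //; rewrite scalerBl addrAC e addrAC subrr add0r //.
have nsr : ~ T (s - r) by move=> /(idealD hT Tr); rewrite addrC subrK.
have {}ih x : x \in l -> sat T L x.
  apply: ih => {}x xl.
  have [|s' Ts' [v' Lv' [r' [w' [Tr' lw' e']]]]] := h x; first by rewrite inE xl orbT.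
  exists ((s - r) * s'); first exact: prime_notM.
  rewrite -scalerA -[s' *: x](subrK v') e' 2!scalerDr scalerA mulrC -scalerA.
  apply: (submodD hA); last by apply: (submodZ _ hA); apply: addsetl => //; exact: lspan_sub.
  apply: (submodD hA); first exact: (submodZ _ hA).
  by apply: (submodZ _ hA); exact: addsetr.
move=> x; rewrite inE => /orP[/eqP ->|/ih //].
rewrite -(sat_id _ pT); exists (s - r) => //.
move: key; apply: addset_min; first exact: sat_submod.
  exact: sat_sub.
apply: lspan_min => [|a y _ /ih hy]; first exact: sat_submod.
by apply: submodZ => //; exact: sat_submod.
Qed.

End Saturation.

(** * Primes, local chain conditions and Cartier submodules *)

Section Primes.
Variables (R : comPzRingType).
Hypothesis nR : noetherian R.

Definition colon (V : lmodType R) (L : set V) (v : V) : set R := [set r | L (r *: v)].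

Lemma colon_ideal (V : lmodType R) (L : set V) v : submodule L -> ideal (colon L v).
Proof.
move=> hL; split; first by rewrite /colon /= scale0r; exact: hL.1.
move=> a x y; rewrite /colon /= => Lx Ly.
by rewrite scalerDl -scalerA; exact: hL.2.
Qed.

(** A maximal one among the colon ideals of the elements of [M] outside [L] is prime. *)
Lemma associated_prime (V : lmodType R) (M L : set V) :
  submodule M -> submodule L -> ~ M `<=` L ->
  exists g, [/\ M g, ~ L g & prime_ideal (colon L g)].
Proof.
move=> hM hL nML.
have /existsNP[v /not_implyP[Mv Lv]] := nML.
have [||_ [[g [Mg Lg] <-] gmax]] := @noeth_max R R^o setT
    [set colon L g | g in [set g | M g /\ ~ L g]] (noeth_ring nR).
- by move=> _ [g _ <-]; split=> //; exact: colon_ideal.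
- by exists (colon L v), v.
exists g; split=> //; split; first exact: colon_ideal.
  by rewrite /colon /= scale1r.
move=> x y xy; have [|ny] := pselect (colon L g y); [by right|left].
suff <- : colon L (y *: g) = colon L g by rewrite /colon /= scalerA.
apply: gmax.
  by exists (y *: g) => //; split=> //; exact: submodZ.
by move=> r rg; rewrite /colon /= scalerA mulrC -scalerA; exact: submodZ.
Qed.

Lemma exists_prime (I : set R) : ideal I -> ~ I 1 ->
  exists2 P, prime_ideal P & I `<=` P.
Proof.
move=> hI I1; have [|g [_ _ pg]] := @associated_prime R^o setT I (submodT _) hI.
  by move=> /(_ 1 Logic.I).
exists (@colon R^o I g) => // r Ir.
by rewrite /colon /= [_ *: _]mulrC; exact: idealM.
Qed.

Lemma exists_minimal_prime (I : set R) : ideal I -> ~ I 1 ->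
  exists T, [/\ prime_ideal T, I `<=` T &
    forall Q, prime_ideal Q -> I `<=` Q -> Q `<=` T -> T `<=` Q].
Proof.
move=> hI I1; have [P0 pP0 IP0] := exists_prime hI I1.
(* Zorn's lemma is applied to complements of primes: the complement of a union of a chain of them is
   an intersection of a chain of primes, hence prime. *)
pose good (A : set R) := prime_ideal (~` A) /\ I `<=` ~` A.
pose fam A := good A \/ A = set0.
have g1 A : good A -> A 1.
  by move=> [[_ h _] _]; apply: contrapT.
have [F FQ Ftot|A [[gA|A0] Amax]] := @Zorn_bigcup R fam.
- have [[X FX [x Xx]]|h] := pselect (exists2 X, F X & exists x, X x); last first.
    right; rewrite -subset0 => x [X FX Xx]; case: h; exists X => //.
    by exists x.
  have gF Y y : F Y -> Y y -> good Y by move=> /FQ[//|->].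
  have gX := gF _ _ FX Xx.
  have UE y : (~` \bigcup_(X in F) X) y <-> forall Y, F Y -> (~` Y) y.
    by split=> [h Y FY Yy|h [Y FY]]; [apply: h; exists Y|exact: h].
  have FT (Y : set R) : F Y -> Y = set0 \/ good Y by move=> /FQ[]; [right|left].
  left; split; last first.
    move=> y Iy; apply/UE => Y /FT[->|[_]]; [by case|exact].
  split.
  + split; first by apply/UE => Y /FT[->|[[h _ _] _]]; [case|exact: ideal0].
    move=> a y z /UE hy /UE hz; apply/UE => Y FY.
    have [->|[[h _ _] _]] := FT Y FY; first by case.
    by apply: h.2; [exact: hy|exact: hz].
  + by move=> /UE /(_ _ FX); apply; exact: g1.
  + move=> y z /UE yz.
    have [|/existsNP[Y /not_implyP[FY Yy]]] := pselect (forall Y, F Y -> (~` Y) y).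
      by move=> /UE; left.
    right; apply/UE => Z FZ Zz; have {}Yy : Y y by exact: contrapT.
    have [YZ|ZY] := Ftot _ _ FY FZ.
      have [[_ _ pZ] _] := gF _ _ FZ Zz.
      by case: (pZ _ _ (yz _ FZ)) => [/(_ (YZ _ Yy))|/(_ Zz)].
    have [[_ _ pY] _] := gF _ _ FY Yy.
    by case: (pY _ _ (yz _ FY)) => [/(_ Yy)|/(_ (ZY _ Zz))].
- exists (~` A); have [pA IA] := gA; split=> // Q pQ IQ QA.
  apply: contrapT => nAQ; apply: (Amax (~` Q)); last by left; rewrite /good setCK.
  split; first by move=> x Ax Qx; exact: (QA x).
  by move=> h; apply: nAQ => x Ax; apply: contrapT => /h.
- exfalso; apply: (Amax (~` P0)); last by left; rewrite /good setCK.
  rewrite A0; split=> [x []|/(_ 1)]; apply.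
  by have [_ ] := pP0.
Qed.

End Primes.

(** * Descending chains of submodules after localization at a prime *)

Section DCC.
Variables (R : comPzRingType) (V : lmodType R) (T : set R).
Hypotheses (nR : noetherian R) (pT : prime_ideal T).
Implicit Types (W U I : set V).

(** This expresses that the localization of [U / W] at [T] is artinian, tested on submodules of [V]
    itself. *)
Definition local_dcc W U : Prop :=
  forall L : nat -> set V, (forall a, [/\ submodule (L a), W `<=` L a & L a `<=` U]) ->
  (forall a b, (a <= b)%N -> L b `<=` L a) ->
  exists a, forall b, (a <= b)%N -> L a `<=` sat T (L b).

Lemma local_dcc_trans W I U : submodule I -> W `<=` I -> I `<=` U -> submodule U ->
  local_dcc W I -> local_dcc I U -> local_dcc W U.
Proof.
move=> hI WI IU hU d1 d2 L hL desc.
have [||a1 h1] := d1 (fun a => L a `&` I).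
- move=> a; have [hLa WL _] := hL a; split; [exact: submodI| |by move=> x []].
  by move=> x Wx; split; [exact: WL|exact: WI].
- by move=> a b /desc ab x [/ab ? ?].
have [||a2 h2] := d2 (fun a => addset (L a) I).
- move=> a; have [hLa _ LU] := hL a; split; first exact: submod_addset.
    exact: addsetr.
  exact: addset_min.
- by move=> a b /desc ab x [y /ab ? ?]; exists y.
exists (maxn a1 a2) => b; rewrite geq_max => /andP[a1b a2b] x Lx.
have [hLb WLb _] := hL b.
have [|s Ts [y Ly Iz]] := h2 b a2b x.
  by apply: (addsetl hI); apply: desc Lx; rewrite leq_maxr.
have [|s' Ts' [Lb _]] := h1 b a1b (s *: x - y).
  split=> //; have [h _ _] := hL a1; apply: (submodB h).
    by apply: (submodZ _ h); apply: desc Lx; rewrite leq_maxl.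
  exact: desc Ly.
exists (s' * s); first exact: prime_notM.
by rewrite -scalerA -[s *: x](subrK y) scalerDr; apply: submodD => //; exact: submodZ.
Qed.

(** The localized quotient is zero or a copy of the residue field of [T]: either every saturated
    term contains [g], or some term lies in the saturation of [I]. *)
Lemma local_dcc_simple I g : submodule I -> (forall r, T r -> sat T I (r *: g)) ->
  local_dcc I (addset I (lspan setT [:: g])).
Proof.
move=> hI Tg L hL desc.
have hs a : submodule (sat T (L a)) by apply: sat_submod => //; case: (hL a).
have [h|/existsNP[a ga]] := pselect (forall a, sat T (L a) g).
  exists 0%N => b _; have [_ _ h0] := hL 0%N; apply: subset_trans h0 _.
  have [_ IL _] := hL b.
  apply: addset_min => //; first exact: subset_trans IL (sat_sub _).
  by apply: lspan_subset => // x; rewrite inE => /eqP ->.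
exists a => b ab x Lx; have [_ ILb _] := hL b.
have [hLa IL LU] := hL a.
apply: (satS ILb).
have [i Ii [r [_ [_ -> xi]]]] := LU _ Lx; rewrite addr0 in xi.
have [Tr|nTr] := pselect (T r).
  rewrite -[x](subrK i) xi; apply: submodD; [exact: sat_submod|exact: Tg|exact: sat_sub].
exfalso; apply: ga; exists r => //; rewrite -xi; apply: submodB => //.
exact: IL.
Qed.

(** Noetherian induction on [I]: an associated prime of [M] modulo the saturation of [I] is
    contained in [T], as its [g] lies outside a saturated submodule. By hypothesis it equals [T], so
    adjoining [g] enlarges [I] by a locally simple layer. *)
Lemma local_dcc_support W M : noeth M -> submodule W -> submodule M -> W `<=` M ->
  (forall v Q, M v -> prime_ideal Q -> Q `<=` T -> colon W v `<=` Q -> T `<=` Q) ->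
  local_dcc W M.
Proof.
move=> nM hW hM WM hQ.
suff h I : submodule I -> I `<=` M -> W `<=` I -> local_dcc I M by exact: h.
move: I; apply: (noeth_ind nM) => I hI IM ih WI.
have [MI|nMI] := pselect (M `<=` sat T I).
  move=> L hL desc; exists 0%N => b _; have [_ _ h0] := hL 0%N; have [_ IL _] := hL b.
  exact: subset_trans h0 (subset_trans MI (satS IL)).
have hsI := sat_submod pT hI.
have [g [Mg ng pg]] := associated_prime nR hM hsI nMI.
have Tg : T `<=` colon (sat T I) g.
  apply: (hQ g) => //.
    move=> r rg; apply: contrapT => nTr; apply: ng; rewrite -(sat_id I pT).
    by exists r.
  by move=> r /WI; exact: sat_sub.
have hI' : submodule (addset I (lspan setT [:: g])).
  exact/submod_addset/lspan_setT_sub.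
have II' : I `<=` addset I (lspan setT [:: g]).
  exact/addsetl/lspan_setT_sub.
have I'M : addset I (lspan setT [:: g]) `<=` M.
  by apply: addset_min => //; apply: lspan_subset => // x; rewrite inE => /eqP ->.
apply: (local_dcc_trans hI' II' I'M hM); first exact: local_dcc_simple.
apply: ih => //; last exact: subset_trans II'.
move=> e; apply: ng; apply: sat_sub => //; rewrite -e; apply: addsetr => //.
by apply: lspan_mem; rewrite inE.
Qed.

End DCC.

(** * Stabilisation of the iterated Cartier operator *)

Section Cartier.
Variables (R : comPzRingType) (N : lmodType R) (p : nat) (Phi : set (N -> N)).
Hypotheses (nR : noetherian R) (p2 : (1 < p)%N).
Hypothesis PhiZ : forall f r m, Phi f -> r *: f m = f (r ^+ p *: m).

Definition cartier (M : set N) : set N :=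
  submod_span [set y | exists f m, [/\ Phi f, M m & y = f m]].

Lemma cartierS M M' : M `<=` M' -> cartier M `<=` cartier M'.
Proof.
move=> h; apply: submod_span_min; first exact: submod_span_sub.
by move=> _ [f [m [Pf Mm ->]]]; apply: submod_span_in; exists f, m; split=> //; exact: h.
Qed.

(** A scalar [r] enters the maps of [Phi] as [r ^+ p]; this carries annihilation from one step of
    the chain to the next. *)
Lemma cartierZ M M' r : submodule M' ->
  (forall m, M m -> M' (r ^+ p *: m)) -> forall x, cartier M x -> cartier M' (r *: x).
Proof.
move=> hM' h; apply: submod_span_min.
  split; first by rewrite scaler0; exact: (submod_span_sub _).1.
  move=> a x y rx ry; rewrite scalerDr scalerA mulrC -scalerA.
  exact: (submod_span_sub _).2.
move=> _ [f [m [Pf Mm ->]]]; rewrite PhiZ //; apply: submod_span_in.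
by exists f, (r ^+ p *: m); split=> //; exact: h.
Qed.

Variable (M0 : set N).
Hypotheses (nM0 : noeth M0) (hM0 : submodule M0) (CM0 : cartier M0 `<=` M0).

Let M a := iter a cartier M0.

Let hM a : submodule (M a).
Proof. by case: a => [//|a]; exact: submod_span_sub. Qed.

Let MS a : M a.+1 `<=` M a.
Proof. by elim: a => [//|a ih]; exact: cartierS. Qed.

Let Mdesc a b : (a <= b)%N -> M b `<=` M a.
Proof.
elim: b => [|b ih]; first by rewrite leqn0 => /eqP ->.
by rewrite leq_eqVlt => /orP[/eqP -> //|/ih]; apply: subset_trans.
Qed.

Let A a : set R := [set r | forall m, M a m -> M a.+1 (r *: m)].

Let hA a : ideal (A a).
Proof.
split=> [m Mm|r x y hx hy m Mm]; first by rewrite scale0r; exact: (hM _).1.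
rewrite scalerDl -scalerA; apply: (hM _).2; [exact: hx|exact: hy].
Qed.

Let AS a : A a `<=` A a.+1.
Proof.
move=> r hr; apply: (cartierZ (hM a.+1)) => m Mm.
rewrite -(prednK (ltnW p2)) exprS -scalerA; apply: hr; exact: submodZ.
Qed.

(* The annihilators of the successive quotients [M a / M a.+1] increase, so
   they stabilise; localizing at a minimal prime [T] of the limit makes
   [M a0 / \bigcap_b M b] of finite length, because [x ^+ 2] kills it for
   every [x] in the limit. *)
Lemma cartier_stable : exists a, forall b, (a <= b)%N ->
  iter b cartier M0 = iter a cartier M0.
Proof.
have [a0 ha0] := @noeth_stable R R^o setT A (noeth_ring nR) hA (fun _ _ _ => Logic.I) AS.
have [A1|nA1] := pselect (A a0 1).
  exists a0; elim=> [|b ih]; first by rewrite leqn0 => /eqP ->.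
  rewrite leq_eqVlt => /orP[/eqP -> //|ab]; rewrite -[RHS]ih //.
  apply/seteqP; split; first exact: MS.
  have := ha0 b ab => e; rewrite -e in A1.
  by move=> x Mx; rewrite -[x]scale1r; exact: A1.
have [T [pT AT Tmin]] := exists_minimal_prime nR (hA a0) nA1.
(* One factor [x] moves [m] into [cartier (M a0)]; the other enters the maps of [Phi] as [x ^+ p], a
   multiple of [x ^+ 2] since [p >= 2], so the induction hypothesis applies. *)
have sq x : A a0 x -> forall b m, M a0 m -> M (a0 + b)%N (x ^+ 2 *: m).
  move=> Ax; elim=> [|b ih] m Mm; first by rewrite addn0; exact: submodZ.
  rewrite addnS expr2 -scalerA.
  suff : forall m, M a0.+1 m -> M (a0 + b).+1 (x *: m) by apply; exact: Ax.
  apply: (cartierZ (hM (a0 + b))) => m' Mm'.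
  rewrite -(subnK p2) exprD -scalerA; apply: (submodZ _ (hM _)).
  exact: ih.
pose W := \bigcap_(b in [set b | (a0 <= b)%N]) M b.
have hW : submodule W.
  split=> [b _|r x y hx hy b hb]; first exact: (hM b).1.
  by apply: (hM b).2; [exact: hx|exact: hy].
have WM : W `<=` M a0 by move=> x /(_ a0); apply => /=.
have nMa0 : noeth (M a0) by apply: noethW nM0; exact: (@Mdesc 0).
have dcc : local_dcc T W (M a0).
  (* A prime containing the annihilator of [v] modulo [W] contains each [x ^+ 2], hence each [x] in
     [A a0], and minimality of [T] applies. *)
  apply: local_dcc_support => // v Q Mv pQ QT hQ.
  apply: Tmin => // x Ax; apply: (prime_exp (k := 2)) => //; apply: hQ.
  by move=> b /= ab; rewrite -(subnKC ab); exact: sq.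
have [||a ha] := dcc (fun b => M (a0 + b)%N).
- move=> a; split=> //; last by apply: Mdesc; rewrite leq_addr.
  by move=> x /(_ (a0 + a)%N); apply; rewrite /= leq_addr.
- by move=> b c bc; apply: Mdesc; rewrite leq_add2l.
have {ha} ha := ha a.+1 (leqnSn _).
have [//||l lE] := nMa0 (M (a0 + a)%N); first by apply: Mdesc; rewrite leq_addr.
have [|s Ts hs] := @sat_fg R N T (M (a0 + a.+1)%N) l pT (hM _).
  by move=> x xl; apply: ha; rewrite lE; exact: lspan_mem.
(* The common denominator [s] sends a term of the chain into the next one, so it lies in the stable
   annihilator and thus in [T]. *)
exfalso; apply: Ts; apply: AT; rewrite -(ha0 (a0 + a)%N) ?leq_addr // => m Mm.
by rewrite -addnS; apply: hs; rewrite -lE.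
Qed.

End Cartier.

(** * Krull's principal ideal theorem and regular local rings *)

Section KrullHeight.
Variable R : comPzRingType.
Hypothesis nR : noetherian R.
Implicit Types (P Q T I : set R) (l : seq R).

Definition idl l : set R := @lspan R R^o setT l.
Definition addI I I' : set R := @addset R R^o I I'.

Lemma idl_ideal l : ideal (idl l). Proof. exact: (@lspan_setT_sub R R^o). Qed.
Lemma addI_ideal I I' : ideal I -> ideal I' -> ideal (addI I I').
Proof. exact: (@submod_addset R R^o). Qed.
Lemma idl_mem l x : x \in l -> idl l x. Proof. exact: (@lspan_mem R R^o). Qed.
Lemma idl_min l I : ideal I -> (forall x, x \in l -> I x) -> idl l `<=` I.
Proof. exact: (@lspan_subset R R^o). Qed.
Lemma idl_fg I : ideal I -> exists l, I = idl l.
Proof. by move=> hI; exact: (noeth_ring nR). Qed.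

Lemma idl_cons x l r : idl (x :: l) r <-> exists a b, idl l b /\ r = a * x + b.
Proof. by split=> [[a [b [_ ? ->]]]|[a [b [? ->]]]]; exists a, b. Qed.

Lemma idl1 x r : idl [:: x] r <-> exists a, r = a * x.
Proof.
rewrite idl_cons; split=> [[a [b [-> ->]]]|[a ->]]; first by exists a; rewrite addr0.
by exists a, 0; split; rewrite ?addr0.
Qed.

Lemma ideal_nakayama T I l : prime_ideal T -> ideal I ->
  (forall x, x \in l -> exists2 s, ~ T s & addI I (@lspan R R^o T l) (s * x)) ->
  forall x, x \in l -> @sat R R^o T I x.
Proof. exact: (@local_nakayama R R^o). Qed.

(** Up to denominators the hypothesis puts [C] inside [I + x C], and [x C] is part of [T C]. *)
Lemma ideal_nakayama_mul T I C x : prime_ideal T -> ideal I -> ideal C -> T x ->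
  (forall y, C y -> exists s r, [/\ ~ T s, C r & I (s * y - r * x)]) ->
  C `<=` @sat R R^o T I.
Proof.
move=> pT hI hC Tx h; have [hT _ _] := pT; have [l Cl] := idl_fg hC.
rewrite Cl; apply: idl_min; first exact: (@sat_submod R R^o _ _ pT hI).
apply: (ideal_nakayama pT hI) => y yl.
have [|s [r [Ts Cr Isy]]] := h y; first by rewrite Cl; exact: idl_mem.
exists s => //; exists (s * y - r * x) => //.
have -> : (s * y : R^o) - (s * y - r * x) = r * x by rewrite opprB addrC subrK.
rewrite Cl in Cr; elim: (l) r Cr {Isy} => [|g l' ih] r /=; first by move=> ->; rewrite mul0r.
move=> /idl_cons[b [c [/ih hc ->]]]; exists (b * x), (c * x).
split=> //; first exact: idealM.
by rewrite mulrDl -[_ *: _]/(_ * _) mulrAC.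
Qed.

Definition mulseq l1 l2 : seq R := [seq a * b | a <- l1, b <- l2].

Lemma idl_mulseq l1 l2 x y : idl l1 x -> idl l2 y -> idl (mulseq l1 l2) (x * y).
Proof.
move=> hx hy; move: x hx.
have h2 : ideal (fun x => idl (mulseq l1 l2) (x * y)).
  split; first by rewrite mul0r; exact: ideal0 (idl_ideal _).
  move=> a u v hu hv; rewrite mulrDl -[a *: u]/(a * u) -mulrA.
  by apply: idealD; [exact: idl_ideal|apply: idealM => //; exact: idl_ideal|].
apply: (idl_min h2) => a al; move: y hy {h2}.
have h2 : ideal (fun y => idl (mulseq l1 l2) (a * y)).
  split; first by rewrite mulr0; exact: ideal0 (idl_ideal _).
  move=> b u v hu hv; rewrite mulrDr -[b *: u]/(b * u) mulrCA.
  by apply: idealD; [exact: idl_ideal|apply: idealM => //; exact: idl_ideal|].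
by apply: (idl_min h2) => b bl; apply: idl_mem; exact: allpairs_f.
Qed.

Fixpoint powseq l n : seq R := if n is n'.+1 then mulseq l (powseq l n') else [:: 1].

Lemma idl_powseq l x n : idl l x -> idl (powseq l n) (x ^+ n).
Proof.
move=> lx; elim: n => [|n ih] /=; first by apply: idl_mem; rewrite inE.
by rewrite exprS; exact: idl_mulseq.
Qed.

Lemma powseqS_sub Q l n : ideal Q -> (forall x, x \in l -> Q x) ->
  idl (powseq l n.+1) `<=` @lspan R R^o Q (powseq l n).
Proof.
move=> hQ lQ; apply: idl_min; first exact: (@lspan_sub R R^o).
move=> _ /allpairsP[[a b] /= [al bl ->]].
by apply: (@lspan_in R R^o) bl => //; exact: lQ.
Qed.

(* Krull's principal ideal theorem, via the symbolic powers [K n] of [Q]. *)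
Lemma no_prime_between P Q T x : prime_ideal P -> prime_ideal Q -> prime_ideal T ->
  P `<=` Q -> Q `<=` T -> T x -> ~ Q x ->
  (forall Q', prime_ideal Q' -> P `<=` Q' -> Q' x -> Q' `<=` T -> T `<=` Q') ->
  Q `<=` P.
Proof.
move=> pP pQ pT PQ QT Tx nQx Tmin.
have [hP _ _] := pP; have [hQ _ _] := pQ; have [hT _ _] := pT.
have [q Qq] := idl_fg hQ.
pose B n := addI P (idl (powseq q n)).
pose K n := @sat R R^o Q (B n).
have hB n : ideal (B n) by apply: addI_ideal => //; exact: idl_ideal.
have hK n : ideal (K n) by exact: (sat_submod pQ (hB n)).
have lq x' : x' \in q -> Q x' by rewrite Qq; exact: idl_mem.
have BS n : B n.+1 `<=` B n.
  apply: (@addset_min R R^o); first exact: (hB n).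
    by apply: (@addsetl R R^o); exact: idl_ideal.
  apply: subset_trans (@addsetr R R^o P _ hP).
  apply: (@subset_trans _ (@lspan R R^o Q (powseq q n))); first exact: powseqS_sub.
  apply: (@lspan_min R R^o); first exact: idl_ideal.
  by move=> r y _ yl; apply: (@submodZ R R^o); [exact: idl_ideal|exact: idl_mem].
have Bdesc a b : (a <= b)%N -> B b `<=` B a.
  elim: b => [|b ih]; first by rewrite leqn0 => /eqP ->.
  by rewrite leq_eqVlt => /orP[/eqP -> //|/ih]; apply: subset_trans.
have PK n : P `<=` K n.
  apply: subset_trans (@sat_sub R R^o _ _ pQ); by apply: (@addsetl R R^o); exact: idl_ideal.
pose W := addI P (idl [:: x]).
have hx := idl_ideal [:: x].
have hW : ideal W by exact: addI_ideal.
(* A prime inside [T] containing [P] and [x] is [T], so the ring modulo [W] is artinian at [T] and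
   the chain [K n + (x)] becomes stationary there. *)
have dcc : @local_dcc R R^o T W setT.
  apply: (@local_dcc_support R R^o) => // [|v Q' _ pQ' Q'T h].
    exact: noeth_ring.
  apply: Tmin => //.
    move=> r Pr; apply: h; apply: (@addsetl R R^o) => //.
    by rewrite [_ *: _]mulrC; exact: idealM.
  apply: h; apply: (@addsetr R R^o) => //.
  by rewrite [_ *: _]mulrC; apply: idealM => //; apply: idl_mem; rewrite inE.
have [a0||a ha] := dcc (fun n => addI (K n) (idl [:: x])).
- split=> //; first exact: (addI_ideal (hK a0) hx).
  apply: (@addset_min R R^o); first exact: (addI_ideal (hK a0) hx).
    by apply: subset_trans (PK a0) _; exact: (@addsetl R R^o).
  exact: (@addsetr R R^o _ _ (hK a0)).
- move=> a b ab y [z Kz xz]; exists z => //.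
  by apply: (@satS R R^o) Kz; exact: Bdesc.
have {ha} ha := ha a.+1 (leqnSn _).
(* In [s * y = z + r * x] with [z] in [K a.+1], the coefficient [r] is again in [K a], as [x] is
   outside [Q] and [K a] is saturated at [Q]. Nakayama at [T] then removes [x K a] from
   [K a.+1 + x K a]. *)
have KS : K a `<=` K a.+1.
  suff h : K a `<=` @sat R R^o T (K a.+1).
    move=> y /h[s Ts Ks]; rewrite /K -(sat_id (V := R^o) _ pQ).
    by exists s => // /QT.
  apply: (ideal_nakayama_mul pT (hK a.+1) (hK a) Tx) => y Ky.
  have [|s Ts [z Kz /idl1[r e]]] := ha y; first by apply: (@addsetl R R^o).
  exists s, r; split=> //; last first.
    by have -> : s * y - r * x = z by rewrite -e opprB addrC subrK.
  rewrite /K -(sat_id (V := R^o) _ pQ); exists x => //.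
  have -> : x *: (r : R^o) = s * y - z by rewrite [LHS]mulrC -e.
  apply: (idealB (hK a)); first exact: (idealM _ (hK a)).
  by apply: (@satS R R^o) Kz; exact: Bdesc.
(* Locally at [Q], the [a]-th power of [Q] now lies in [P] plus the next power; Nakayama at [Q] puts
   it in [P]. *)
have pwP y : y \in powseq q a -> P y.
  move=> yl.
  have [z zl|s Qs Ps] := ideal_nakayama pQ hP _ yl; last first.
    by have [_ _ /(_ _ _ Ps)[/PQ|]] := pP.
  have /KS[s Qs [u Pu hu]] : K a z.
    by apply: (@sat_sub R R^o) => //; apply: (@addsetr R R^o) => //; exact: idl_mem.
  exists s => //; exists u => //; move: hu; exact: powseqS_sub.
move=> y Qy; apply: (prime_exp pP (k := a)).
move: (idl_powseq a (l := q) (x := y)); rewrite -Qq => /(_ Qy).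
exact: idl_min.
Qed.

(** Otherwise [x] would be outside [Q] and [T] minimal over [P] and [x], against the principal ideal
    theorem. The middle prime of a chain can thus be moved so as to contain [x]. *)
Lemma prime_between P Q T x : prime_ideal P -> prime_ideal Q -> prime_ideal T ->
  P `<=` Q -> ~ Q `<=` P -> Q `<=` T -> ~ T `<=` Q -> T x ->
  exists Q', [/\ prime_ideal Q', P `<=` Q', ~ Q' `<=` P, Q' `<=` T & ~ T `<=` Q' /\ Q' x].
Proof.
move=> pP pQ pT PQ nQP QT nTQ Tx.
have [Qx|nQx] := pselect (Q x); first by exists Q.
apply: contrapT => nQ'; apply: nQP; apply: (no_prime_between (x := x) pP pQ pT) => //.
move=> Q' pQ' PQ' Q'x Q'T; apply: contrapT => nTQ'; apply: nQ'; exists Q'; split=> //.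
by move=> /(_ _ Q'x) /PQ.
Qed.

(** In terms of height: the height of [T] modulo [I] is at least [n], witnessed by a strict chain of
    primes. *)
Fixpoint below I n T : Prop :=
  match n with
  | 0 => prime_ideal T /\ I `<=` T
  | n'.+1 => prime_ideal T /\ exists P, [/\ below I n' P, P `<=` T & ~ T `<=` P]
  end.

Lemma below_prime I n T : below I n T -> prime_ideal T /\ I `<=` T.
Proof.
elim: n T => [//|n ih] T /= [pT [P [/ih[_ IP] PT _]]]; split=> //.
exact: subset_trans PT.
Qed.

Lemma below_ext I n T T' : prime_ideal T' -> T `<=` T' -> below I n T -> below I n T'.
Proof.
case: n => [|n] pT' TT' /=; first by move=> [_ IT]; split=> //; exact: subset_trans TT'.
move=> [_ [P [bP PT nTP]]]; split=> //; exists P; split=> //.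
  exact: subset_trans TT'.
by move=> h; apply: nTP; exact: subset_trans h.
Qed.

(** Going down from [T], each intermediate prime is exchanged for one containing [x]; only the
    bottom prime is lost. *)
Lemma below_shift I n T x : T x -> below I n.+1 T -> below (addI I (idl [:: x])) n T.
Proof.
elim: n T => [|n ih] T Tx [pT [P [bP PT nTP]]] /=.
  split=> //; apply: (@addset_min R R^o); first by case: pT.
    by apply: subset_trans PT; case: bP.
  by apply: idl_min; [case: pT|move=> y; rewrite inE => /eqP ->].
move: bP => [pP [P' [bP' P'P nPP']]].
have [Q [pQ P'Q nQP' QT [nTQ Qx]]] :=
  prime_between (below_prime bP').1 pP pT P'P nPP' PT nTP Tx.
split=> //; exists Q; split=> //; apply: ih => //; split=> //.
by exists P'.
Qed.

(** * Local rings: the dimension bound, and regular quotients as domains *)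

Section Local.
Variable m : set R.
Hypotheses (hm : ideal m) (m1 : ~ m 1) (mU : forall x, ~ m x -> exists y, x * y = 1).

Lemma local_prime : prime_ideal m.
Proof.
split=> // x y mxy; have [|/mU[z xz]] := pselect (m x); [by left|right].
by rewrite -[y]mul1r -xz mulrAC; exact: (ideal_mulr _ hm mxy).
Qed.

Lemma local_le P : prime_ideal P -> P `<=` m.
Proof.
move=> [hP P1 _] x Px; apply: contrapT => /mU[y xy]; apply: P1.
by rewrite -xy; exact: (ideal_mulr _ hP Px).
Qed.

Lemma sat_local I : ideal I -> @sat R R^o m I `<=` I.
Proof.
move=> hI y [s /mU[t st] Is]; rewrite -[y]mul1r -st [s * t]mulrC -mulrA.
exact: idealM.
Qed.

Lemma ideal_nakayama_local I C x : ideal I -> ideal C -> m x ->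
  (forall y, C y -> exists2 r, C r & I (y - r * x)) -> C `<=` I.
Proof.
move=> hI hC mx h; apply: subset_trans (sat_local hI).
apply: (ideal_nakayama_mul local_prime hI hC mx) => y /h[r Cr Iy].
by exists 1, r; rewrite mul1r.
Qed.

Lemma below_local I n T : below I n T -> below I n m.
Proof.
move=> h; have [pT _] := below_prime h.
by apply: below_ext h; [exact: local_prime|exact: local_le].
Qed.

Lemma addI_idl_cons I x l : ideal I -> addI (addI I (idl [:: x])) (idl l) = addI I (idl (x :: l)).
Proof.
move=> hI; have hl := idl_ideal l; have hxl := idl_ideal (x :: l); have hx := idl_ideal [:: x].
have h1 := addI_ideal hI hx.
have h2 := addI_ideal h1 hl; have h3 := addI_ideal hI hxl.
apply/seteqP; split.
  apply: (@addset_min R R^o) => //.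
    apply: (@addset_min R R^o) => //; first exact: (@addsetl R R^o).
    apply: idl_min => // y; rewrite inE => /eqP ->.
    by apply: (@addsetr R R^o) => //; apply: idl_mem; rewrite inE eqxx.
  apply: idl_min => // y yl.
  by apply: (@addsetr R R^o) => //; apply: idl_mem; rewrite inE yl orbT.
apply: (@addset_min R R^o) => //.
  apply: subset_trans (@addsetl R R^o _ _ hl); exact: (@addsetl R R^o).
apply: idl_min => // y; rewrite inE => /orP[/eqP ->|yl].
  apply: (@addsetl R R^o) => //; apply: (@addsetr R R^o) => //.
  by apply: idl_mem; rewrite inE.
by apply: (@addsetr R R^o) => //; exact: idl_mem.
Qed.

Lemma addI_nil I : ideal I -> addI I (idl [::]) = I.
Proof.
move=> hI; apply/seteqP; split=> [x [y Iy /= /eqP]|]; last first.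
  by apply: (@addsetl R R^o); exact: idl_ideal.
by rewrite subr_eq0 => /eqP ->.
Qed.

(** Adding one generator to [I] shortens the chain by at most one step, and no step remains once [I]
    is [m]. *)
Lemma height_le I l n : ideal I -> addI I (idl l) = m -> below I n m -> (n <= size l)%N.
Proof.
elim: l I n => [|x l ih] I n hI.
  rewrite addI_nil // => -> ; case: n => [//|n] [_ [P [/below_prime[_ mP] _]]].
  by move=> /(_ mP).
rewrite -addI_idl_cons // => e; case: n => [//|n] bn.
apply: (ih (addI I (idl [:: x]))) => //; first by apply: addI_ideal => //; exact: idl_ideal.
apply: below_shift => //; rewrite -e; apply: (@addsetl R R^o); first exact: idl_ideal.
by apply: (@addsetr R R^o) => //; apply: idl_mem; rewrite inE.
Qed.

Lemma below_chain I n T : below I n T -> exists2 P, prime_ideal P &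
  [/\ I `<=` P, below P n T & P `<=` T].
Proof.
elim: n T => [|n ih] T; first by move=> [pT IT]; exists T => //; split=> //=; by [split|move=> x].
move=> [pT [P [/ih[P0 pP0 [IP0 P0P P0P']] PT nTP]]]; exists P0 => //; split=> //.
- by split=> //; exists P.
- exact: subset_trans PT.
Qed.

(** A regular local ring is a domain. With [I + (x)] prime by induction and [P0] the bottom of the
    given chain, [P0 = I + x P0], so Nakayama gives [I = P0]. *)
Lemma regular_prime I l : ideal I -> addI I (idl l) = m -> below I (size l) m -> prime_ideal I.
Proof.
elim: l I => [|x l ih] I hI.
  by rewrite addI_nil // => -> _; exact: local_prime.
move=> e b; have mx : m x.
  by rewrite -e; apply: (@addsetr R R^o) => //; apply: idl_mem; rewrite inE eqxx.
have := e; rewrite -addI_idl_cons // => e'.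
set I' := addI I (idl [:: x]) in e'.
have hI' : ideal I' by apply: addI_ideal => //; exact: idl_ideal.
have pI' : prime_ideal I' by apply: ih => //; exact: below_shift.
have [P0 pP0 [IP0 bP0 P0m]] := below_chain b; have [hP0 P01 P0M] := pP0.
(* Otherwise [l] alone would generate [m] modulo [P0], one element too few for the height bound. *)
have nP0x : ~ P0 x.
  move=> P0x; have := @height_le P0 l (size l).+1 hP0.
  rewrite ltnn => h; suff : false by []; apply: h => //.
  apply/seteqP; split.
    apply: (@addset_min R R^o) => //; apply: idl_min => // y yl.
    by rewrite -e; apply: (@addsetr R R^o) => //; apply: idl_mem; rewrite inE yl orbT.
  rewrite -e'; apply: (@addset_min R R^o); first by apply: addI_ideal => //; exact: idl_ideal.
    apply: (@addset_min R R^o); first by apply: addI_ideal => //; exact: idl_ideal.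
      by apply: subset_trans IP0 _; apply: (@addsetl R R^o); exact: idl_ideal.
    apply: idl_min => [|y]; first by apply: addI_ideal => //; exact: idl_ideal.
    by rewrite inE => /eqP ->; apply: (@addsetl R R^o) => //; exact: idl_ideal.
  exact: (@addsetr R R^o).
(* Otherwise [I'] lies strictly below every prime containing [P0] and [x], and prolongs a chain of
   such primes beyond what the generators [l] allow. *)
have P0I' : P0 `<=` I'.
  apply: contrapT => nP0I'.
  have b' : below (addI P0 (idl [:: x])) (size l) m by exact: below_shift.
  have : below I' (size l).+1 m.
    move: b'; move: (size l) (m); elim=> [|k ihk] T /=.
      move=> [pT PT]; have [hT _ _] := pT; split=> //; exists I'; split=> //.
      - by split=> // y.
      - apply: (@addset_min R R^o) => //.
          apply: subset_trans IP0 (subset_trans _ PT).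
          by apply: (@addsetl R R^o); exact: idl_ideal.
        by apply: subset_trans PT; exact: (@addsetr R R^o).
      - move=> TI'; apply: nP0I'; apply: subset_trans TI'; apply: subset_trans PT.
        by apply: (@addsetl R R^o); exact: idl_ideal.
    by move=> [pT [Q [/ihk bQ QT nTQ]]]; split=> //; exists Q.
  by move=> /(height_le hI' e'); rewrite ltnn.
suff : P0 `<=` I by move=> P0I; have -> : I = P0 by apply/seteqP.
apply: (ideal_nakayama_local hI hP0 mx) => y P0y.
have [i Ii /idl1[r er]] := P0I' _ P0y.
exists r; last by rewrite -er opprB addrC subrK.
have /P0M[] // : P0 (r * x).
by rewrite -er; apply: idealB => //; exact: IP0.
Qed.

End Local.
End KrullHeight.

(** * Regular sequences and freeness over Frobenius *)

Section RegularSequences.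
Variable R : comPzRingType.
Implicit Types (I : set R) (l : seq R).

Lemma idl_eq_mem l1 l2 : l1 =i l2 -> idl l1 = idl l2.
Proof.
move=> e; apply/seteqP; split; apply: idl_min; try exact: idl_ideal.
  by move=> x xl; apply: idl_mem; rewrite -e.
by move=> x xl; apply: idl_mem; rewrite e.
Qed.

Lemma idl_cat l1 l2 : addI (idl l1) (idl l2) = idl (l1 ++ l2).
Proof.
have h1 := idl_ideal l1; have h2 := idl_ideal l2; have h := idl_ideal (l1 ++ l2).
apply/seteqP; split.
  by apply: (@addset_min R R^o) => //; apply: idl_min => // x xl; apply: idl_mem;
    rewrite mem_cat xl ?orbT.
apply: idl_min; first exact: addI_ideal.
move=> x; rewrite mem_cat => /orP[] xl.
  by apply: (@addsetl R R^o) => //; exact: idl_mem.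
by apply: (@addsetr R R^o) => //; exact: idl_mem.
Qed.

Hypothesis nR : noetherian R.
Variable m : set R.
Hypotheses (hm : ideal m) (m1 : ~ m 1) (mU : forall x, ~ m x -> exists y, x * y = 1).

Lemma below_shift_seq I l n : ideal I -> (forall x, x \in l -> m x) ->
  below I (size l + n) m -> below (addI I (idl l)) n m.
Proof.
elim: l I => [|x l ih] I hI lm b; first by rewrite addI_nil.
rewrite -addI_idl_cons //; apply: ih => //.
- by apply: addI_ideal => //; exact: idl_ideal.
- by move=> y yl; apply: lm; rewrite inE yl orbT.
- by apply: below_shift => //; apply: lm; rewrite inE eqxx.
Qed.

(* [l] is a regular system of parameters of the local ring [(R, m)]. *)
Definition rsop l : Prop := idl l = m /\ below [set 0] (size l) m.

Lemma rsop_perm l1 l2 : perm_eq l1 l2 -> rsop l1 -> rsop l2.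
Proof.
move=> e [g b]; split; first by rewrite -g; apply: idl_eq_mem => x; rewrite (perm_mem e).
by rewrite -(perm_size e).
Qed.

Lemma rsop_below l1 l2 : rsop (l1 ++ l2) -> below (idl l1) (size l2) m.
Proof.
move=> [g b]; have h0 : ideal [set 0 : R] by split=> // a x y -> ->; rewrite scaler0 addr0.
rewrite size_cat in b.
have := below_shift_seq (l := l1) (n := size l2) h0 _ b.
suff -> : addI [set 0] (idl l1) = idl l1.
  by apply => x xl; rewrite -g; apply: idl_mem; rewrite mem_cat xl.
apply/seteqP; split=> [x [_ -> ]|]; first by rewrite subr0.
exact: (@addsetr R R^o).
Qed.

Lemma rsop_prime l1 l2 : rsop (l1 ++ l2) -> prime_ideal (idl l1).
Proof.
move=> h; have b := rsop_below h; case: h => g _.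
by apply: (regular_prime nR hm m1 mU (l := l2)) b; [exact: idl_ideal|rewrite idl_cat].
Qed.

Lemma rsop_notin l1 x l2 : rsop (l1 ++ x :: l2) -> ~ idl l1 x.
Proof.
move=> h xl1; have b := rsop_below h; case: h => g _.
have := height_le nR (l := l2) (idl_ideal l1) _ b.
rewrite ltnn; suff e : addI (idl l1) (idl l2) = m by move/(_ e).
rewrite idl_cat -g; apply/seteqP; split; apply: idl_min; try exact: idl_ideal.
  by move=> y; rewrite mem_cat => /orP[] yl; apply: idl_mem; rewrite mem_cat ?inE yl ?orbT.
move=> y; rewrite mem_cat inE => /or3P[yl|/eqP ->|yl].
- by apply: idl_mem; rewrite mem_cat yl.
- rewrite -idl_cat; apply: (@addsetl R R^o) => //; exact: idl_ideal.
- by apply: idl_mem; rewrite mem_cat yl orbT.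
Qed.

Definition pows (l : seq (R * nat)) := [seq x.1 ^+ x.2 | x <- l].

(** Induction on the sum of the exponents. If all are one, the ideal is prime and misses [x].
    Otherwise an exponent [a.+2] is lowered to [a.+1], giving [r = v * y ^+ a.+1 + j], and [v] has
    to be put in the ideal of [y] and the other powers. *)
Lemma regular_pows (n : nat) (l : seq (R * nat)) x l2 r :
  (sumn [seq y.2 | y <- l] <= n)%N -> all (fun y => 0 < y.2)%N l ->
  rsop ([seq y.1 | y <- l] ++ x :: l2) ->
  idl (pows l) (x * r) -> idl (pows l) r.
Proof.
elim: n l x l2 r => [|n ih] l x l2 r ln lpos reg xr.
  have [_ _ h] := rsop_prime reg; have nx := rsop_notin reg.
  have l0 : l = [::].
    case: l {xr reg h nx} ln lpos => [//|[y [|a]] l] //=.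
  by move: h nx xr; rewrite l0 /= => h nx /h[/nx|].
have [l1|] := boolP (all (fun y => y.2 == 1)%N l).
  have e : pows l = [seq y.1 | y <- l].
    by apply/eq_in_map => y /(allP l1) /eqP ->; rewrite expr1.
  rewrite e in xr *; have [_ _ /(_ _ _ xr)[/(rsop_notin reg)|]//] := rsop_prime reg.
move=> /allPn[[y a] yl /= a1].
have a2 : (1 < a)%N by have /= := allP lpos _ yl; case: (a) a1 => [|[]].
case: a a2 yl {a1} => [|[|a]] // _ yl.
set l' := rem (y, a.+2) l.
have pl : perm_eq l ((y, a.+2) :: l') by exact: perm_to_rem.
have lE : idl (pows l) = idl (y ^+ a.+2 :: pows l').
  by apply: idl_eq_mem => z; rewrite (perm_mem (perm_map _ pl)).
have lsub : (a.+2 + sumn [seq z.2 | z <- l'] <= n.+1)%N.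
  by apply: leq_trans ln; rewrite (perm_sumn (perm_map (fun y => y.2) pl)).
have l'pos : all (fun z => 0 < z.2)%N l' by move: lpos; rewrite (perm_all _ pl).
have reg' : rsop (y :: [seq z.1 | z <- l'] ++ x :: l2).
  by apply: rsop_perm reg; rewrite -cat_cons perm_cat2r (perm_map _ pl).
have hJ b : ideal (idl (y ^+ b :: pows l')) by exact: idl_ideal.
have hJ' : ideal (idl (pows l')) by exact: idl_ideal.
have memJ b u j : idl (pows l') j -> idl (y ^+ b :: pows l') (u * y ^+ b + j).
  by move=> hj; apply/idl_cons; exists u, j.
have : idl (y ^+ a.+1 :: pows l') r.
  apply: (ih ((y, a.+1) :: l') x l2) => //=.
  move: xr; rewrite lE => /idl_cons[u [j [hj ->]]].
  by rewrite [y ^+ a.+2]exprS mulrA; exact: memJ.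
move=> /idl_cons[v [j [hj rE]]].
move: xr; rewrite lE => /idl_cons[u [j' [hj' xrE]]].
have hv : idl (y ^+ 1 :: pows l') v.
  apply: (ih ((y, 1%N) :: l') x l2) => //=.
    by rewrite -ltnS; apply: leq_trans lsub; rewrite ltn_add2r.
  (* The parameters may be permuted, so [y] can play the role of [x]; removing it from the list
     lowers the sum. *)
  have yreg s : idl (pows l') (y * s) -> idl (pows l') s.
    apply: (ih l' y (x :: l2)) => //.
      by rewrite -ltnS; apply: leq_trans lsub; rewrite addSn ltnS leq_addl.
    apply: rsop_perm reg'; by rewrite -cat1s perm_catCA.
  have yregX b s : idl (pows l') (y ^+ b * s) -> idl (pows l') s.
    elim: b s => [|b ihb] s; first by rewrite mul1r.
    by rewrite exprSr -mulrA => /ihb /yreg.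
  (* Equating the two expressions of [x * r] puts [y ^+ a.+1] times this element in the ideal; the
     power of [y] then cancels. *)
  have : idl (pows l') (x * v - u * y).
    apply: (yregX a.+1).
    have -> : y ^+ a.+1 * (x * v - u * y) = j' - x * j.
      have -> : j' = x * r - u * y ^+ a.+2 by rewrite xrE; ring.
      by rewrite rE !exprS; ring.
    by apply: idealB => //; exact: idealM.
  move=> h; have -> : x * v = u * y ^+ 1 + (x * v - u * y) by rewrite expr1; ring.
  exact: memJ.
move: hv => /idl_cons[w [j1 [hj1 vE]]].
have -> : r = w * y ^+ a.+2 + (y ^+ a.+1 * j1 + j).
  by rewrite rE vE !exprS expr0; ring.
by apply: memJ; apply: idealD => //; exact: idealM.
Qed.

End RegularSequences.

(** * Freeness of a regular local ring over itself through Frobenius *)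

Section FrobeniusFree.
Variables (p : nat) (R : comPzRingType).
Hypotheses (pp : prime p) (pR : p%:R = 0 :> R).

(** The ring is a module over itself through Frobenius: the coordinates are the [c i], not their
    powers, so freeness means that the [c i] vanish. *)
Definition pcomb (I : finType) (e c : I -> R) : R := \sum_i c i ^+ p * e i.
Definition pgenerates (I : finType) (e : I -> R) : Prop :=
  forall x : R, exists c, x = pcomb e c.

Lemma expr0p : 0 ^+ p = 0 :> R.
Proof. by rewrite expr0n -leqn0 leqNgt prime_gt0. Qed.

Lemma pcomb0 (I : finType) (e : I -> R) : pcomb e (fun=> 0) = 0.
Proof. by rewrite /pcomb big1 // => i _; rewrite expr0p mul0r. Qed.

Lemma pcombD (I : finType) (e c d : I -> R) :
  pcomb e (fun i => c i + d i) = pcomb e c + pcomb e d.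
Proof. by rewrite -big_split /=; apply: eq_bigr => i _; rewrite exprDp // mulrDl. Qed.

Lemma pcombZ (I : finType) (e c : I -> R) a :
  pcomb e (fun i => a * c i) = a ^+ p * pcomb e c.
Proof. by rewrite mulr_sumr; apply: eq_bigr => i _; rewrite exprMn mulrA. Qed.

Lemma pcombB (I : finType) (e c d : I -> R) :
  pcomb e (fun i => c i - d i) = pcomb e c - pcomb e d.
Proof.
apply: (addIr (pcomb e d)); rewrite subrK -pcombD; apply: eq_bigr => i _.
by rewrite subrK.
Qed.

Lemma pcomb_sum (I J : finType) (e : I -> R) (c : J -> I -> R) :
  pcomb e (fun i => \sum_j c j i) = \sum_j pcomb e (c j).
Proof.
have -> : pcomb e (fun i => \sum_j c j i) = \sum_i \sum_j c j i ^+ p * e i.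
  apply: eq_bigr => i _; rewrite -mulr_suml; congr (_ * _).
  by apply: (big_morph (fun x : R => x ^+ p)) => [x y|]; [exact: exprDp|exact: expr0p].
exact: exchange_big.
Qed.

Lemma idl_frob (l : seq R) x : idl l x -> idl [seq y ^+ p | y <- l] (x ^+ p).
Proof.
elim: l x => [|y l ih] x /=; first by move=> ->; rewrite expr0p.
move=> /idl_cons[a [b [/ih hb ->]]]; apply/idl_cons; exists (a ^+ p), (b ^+ p).
by rewrite exprDp // exprMn.
Qed.

Hypothesis nR : noetherian R.
Variable m : set R.
Hypotheses (hm : ideal m) (m1 : ~ m 1) (mU : forall x, ~ m x -> exists y, x * y = 1).

Lemma minimal_pgenerates k (e : 'I_k -> R) : pgenerates e ->
  (forall k' (e' : 'I_k' -> R), pgenerates e' -> (k <= k')%N) ->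
  forall c, pcomb e c = 0 -> forall i, m (c i).
Proof.
case: k e => [|k] e ge mink c e0 i; first by case: i.
apply: contrapT => /mU[y cy].
suff /mink : pgenerates (fun j => e (lift i j)) by rewrite ltnn.
move=> x; have [d ->] := ge x.
exists (fun j => d (lift i j) - d i * y * c (lift i j)).
rewrite -[LHS]subr0 -{1}(mulr0 ((d i * y) ^+ p)) -{1}e0 -pcombZ -pcombB.
rewrite /pcomb (bigD1 i) //= -mulrA [y * _]mulrC cy mulr1 subrr.
rewrite expr0p mul0r add0r.
rewrite (reindex_omap (lift i) (unlift i)) /=; last first.
  by move=> j; rewrite eq_sym; case: unliftP => [j' ->|->] //; rewrite ?liftK ?eqxx.
by apply: eq_big => j; rewrite ?liftK ?eqxx ?andbT // eq_sym neq_lift.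
Qed.

(** The claim is generalised to prefixes [l1] of the parameters: a relation modulo the [p]-th powers
    of [l1] has coefficients in the ideal of [l1]. The full list follows from minimality, the empty
    one is freeness. *)
Lemma pgenerates_free k (e : 'I_k -> R) l : rsop m l -> pgenerates e ->
  (forall k' (e' : 'I_k' -> R), pgenerates e' -> (k <= k')%N) ->
  forall c, pcomb e c = 0 -> forall i, c i = 0.
Proof.
move=> reg ge mink.
suff h l2 : forall l1, l1 ++ l2 = l -> forall c,
    idl [seq y ^+ p | y <- l1] (pcomb e c) -> forall i, idl l1 (c i).
  by move=> c c0 i; apply: (h l [::] (erefl _) c); rewrite /= c0.
elim: l2 => [|x l2 ih] l1 lE c hc i.
  rewrite cats0 in lE; have [g _] := reg; rewrite lE in hc *.
  (* The value is also attained with coefficients in [m]; the difference is an exact relation, to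
     which minimality applies. *)
  have [d [md de]] : exists d : 'I_k -> R, (forall j, m (d j)) /\ pcomb e c = pcomb e d.
    have : forall y, y \in l -> m y by move=> y yl; rewrite -g; exact: idl_mem.
    move: hc; elim: (l) (pcomb e c) => [|y l' ihl] z /=.
      by move=> -> _; exists (fun=> 0); split=> [_|]; [exact: ideal0|rewrite pcomb0].
    move=> /idl_cons[a [b [/ihl hb ->]]] lm.
    have [|d [md ->]] := hb; first by move=> y' yl; apply: lm; rewrite inE yl orbT.
    have [d' ->] := ge a.
    exists (fun j => y * d' j + d j); split=> [j|].
      by apply: idealD => //; apply: ideal_mulr => //; apply: lm; rewrite inE eqxx.
    by rewrite pcombD pcombZ mulrC.
  have := @minimal_pgenerates k e ge mink (fun j => c j - d j).
  rewrite pcombB de subrr => /(_ erefl i) h; rewrite g -[c i](subrK (d i)).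
  exact: idealD.
have reg' : rsop m (l1 ++ x :: l2) by rewrite lE.
set J := idl [seq y ^+ p | y <- l1].
have hJ : ideal J by exact: idl_ideal.
have Jpows : J = idl (pows [seq (y, p) | y <- l1]) by rewrite /J /pows -map_comp.
have xreg r : J (x * r) -> J r.
  rewrite Jpows; apply: (regular_pows nR hm m1 mU (leqnn _) (l2 := l2)).
    by apply/allP => _ /mapP[y _ ->] /=; exact: prime_gt0.
  by rewrite -map_comp map_id.
have xregX b r : J (x ^+ b * r) -> J r.
  by elim: b r => [|b ihb] r; [rewrite mul1r|rewrite exprSr -mulrA => /ihb /xreg].
(* All [i]-th coefficients of relations modulo [J] are treated together, so that Nakayama applies to
   [C] inside the ideal of [l1] plus [x C]. *)
pose C := [set y | exists c, J (pcomb e c) /\ c i = y].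
have hC : ideal C.
  split.
    by exists (fun=> 0); split=> //; rewrite pcomb0; exact: ideal0.
  move=> a _ _ [c1 [h1 <-]] [c2 [h2 <-]]; exists (fun j => a * c1 j + c2 j); split=> //.
  by rewrite pcombD pcombZ; apply: idealD => //; exact: idealM.
have mx : m x by case: reg' => <- _; apply: idl_mem; rewrite mem_cat inE eqxx orbT.
have pm : prime_ideal m by exact: local_prime.
have hl1 := idl_ideal l1.
suff : C `<=` idl l1 by apply; exists c.
apply: (ideal_nakayama_local nR hm m1 mU hl1 hC mx) => _ [c' [hc' <-]].
have hcx j : exists v : R * R, idl l1 v.1 /\ c' j = v.1 + v.2 * x.
  have : idl (l1 ++ [:: x]) (c' j).
    apply: (ih (l1 ++ [:: x])); first by rewrite -catA.
    rewrite map_cat -idl_cat; apply: (@addsetl R R^o) => //; exact: idl_ideal.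
  rewrite -idl_cat => -[u hu /idl1[v ev]]; exists (u, v); split=> //=.
  by rewrite -ev addrC subrK.
have [uv huv] := choice hcx.
exists (uv i).2; last by rewrite (huv i).2 addrK; case: (huv i).
exists (fun j => (uv j).2); split=> //.
(* Frobenius sends the parts in the ideal of [l1] into [J]; what remains is [x ^+ p] times the new
   combination, and [x] is regular modulo [J]. *)
apply: (xregX p); rewrite -pcombZ.
have -> : pcomb e (fun j => x * (uv j).2) = pcomb e c' - pcomb e (fun j => (uv j).1).
  rewrite -pcombB; congr pcomb; apply/funext => j.
  by rewrite (huv j).2 addrAC subrr add0r mulrC.
apply: idealB => //; apply: (@submod_sum R R^o) => // j _.
by apply: ideal_mulr => //; apply: idl_frob; case: (huv j).
Qed.

End FrobeniusFree.

Section RegularLocal.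
Variables (p : nat) (S : comPzRingType).
Hypotheses (pp : prime p) (pS : p%:R = 0 :> S).

Lemma exists_maximal_ideal (I : set S) : noetherian S -> ideal I -> ~ I 1 ->
  exists2 M, maximal_ideal M & I `<=` M.
Proof.
move=> nS hI I1.
have [||M [[hM M1 IM] Mmax]] := @noeth_max S S^o setT
    [set J : set S | [/\ ideal J, ~ J 1 & I `<=` J]] (noeth_ring nS).
- by move=> L [].
- by exists I; split=> // y.
exists M => //; split=> // J hJ J1 MJ; apply: Mmax => //; split=> //.
exact: subset_trans MJ.
Qed.

(** A prime chain of length [d] makes the [d] generators of the maximal ideal a regular system of
    parameters; a generating family of least size is then a basis. *)
Lemma regular_local_free : regular_local S -> F_finite p S ->
  exists k (e : 'I_k -> S), pgenerates p e /\
    forall c, pcomb p e c = 0 -> forall i, c i = 0.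
Proof.
move=> [nS [m [[hm m1 _] muniq [d [x [[[P [Pp Pc]] _] mx]]]]]] [k0 [e0 ge0]].
have mU y : ~ m y -> exists z, y * z = 1.
  move=> my; have [/idl1[z e]|h] := pselect (idl [:: y] 1).
    by exists z; rewrite mulrC.
  have [M' /muniq -> ym] := exists_maximal_ideal nS (idl_ideal _) h.
  by case: my; apply: ym; apply: idl_mem; rewrite inE.
have reg : rsop m (codom x).
  split.
    rewrite mx; apply/seteqP; split.
      apply: idl_min; first exact: (@submod_span_sub S S^o).
      by move=> y /codomP[i ->]; apply: (@submod_span_in S S^o); exists i.
    apply: (@submod_span_min S S^o); first exact: idl_ideal.
    by move=> _ [i _ <-]; apply: idl_mem; exact: codom_f.
  rewrite size_codom card_ord; apply: (below_local hm m1 mU (T := P d)).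
  suff h i : (i <= d)%N -> below [set 0] i (P i) by exact: h.
  elim: i => [|i ih] id; have pi := Pp _ id.
    by split=> // y ->; case: pi => /ideal0.
  split=> //; exists (P i); split; [exact/ih/ltnW|by case: (Pc i id)|].
  move=> h; have [h1 h2] := Pc i id; apply: h2; exact/seteqP.
pose Q k := `[< exists e : 'I_k -> S, pgenerates p e >].
have exQ : exists k, Q k by exists k0; apply/asboolP; exists e0.
have [k /asboolP[e ge] mink] := ex_minnP exQ.
exists k, e; split=> //; apply: (pgenerates_free pp pS nS hm m1 mU reg ge).
by move=> k' e' ge'; apply: mink; apply/asboolP; exists e'.
Qed.
End RegularLocal.

(** * F-finiteness and the Frobenius dual basis *)

Section FFinite.
Variables (p : nat) (R : comPzRingType).
Hypotheses (pp : prime p) (pR : p%:R = 0 :> R).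

Definition pspan (I : finType) (e : I -> R) : set R := range (pcomb p e).

Lemma pspanD (I : finType) (e : I -> R) x y : pspan e x -> pspan e y -> pspan e (x + y).
Proof. by move=> [c _ <-] [d _ <-]; eexists; last exact: pcombD. Qed.

Lemma pspanZ (I : finType) (e : I -> R) a x : pspan e x -> pspan e (a ^+ p * x).
Proof. by move=> [c _ <-]; eexists; last exact: pcombZ. Qed.

Lemma pspan_gen (I : finType) (e : I -> R) i : pspan e (e i).
Proof.
exists (fun j => (j == i)%:R) => //; rewrite /pcomb (bigD1 i) //= eqxx expr1n mul1r.
by rewrite big1 ?addr0 // => j /negPf ->; rewrite expr0p // mul0r.
Qed.

Lemma pspan_min (I : finType) (e : I -> R) (Q : set R) : Q 0 ->
  (forall x y, Q x -> Q y -> Q (x + y)) -> (forall i a, Q (a ^+ p * e i)) ->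
  pspan e `<=` Q.
Proof. by move=> Q0 QD Qe _ [c _ <-]; rewrite /pcomb; elim/big_ind: _. Qed.

Lemma pspan0 (I : finType) (e : I -> R) : pspan e 0.
Proof. by exists (fun=> 0) => //; exact: pcomb0. Qed.

Lemma pspan_subring (I : finType) (e : I -> R) : pspan e 1 ->
  (forall i j, pspan e (e i * e j)) -> subring (pspan e).
Proof.
move=> e1 eM; split=> //.
  by move=> _ _ [c _ <-] [d _ <-]; eexists; last exact: pcombB.
move=> x y ex; move: y; apply: pspan_min.
- by rewrite mulr0; exact: pspan0.
- by move=> y z hy hz; rewrite mulrDr; exact: pspanD.
- move=> j a; move: x ex; apply: pspan_min.
  + by rewrite mul0r; exact: pspan0.
  + by move=> y z hy hz; rewrite mulrDl; exact: pspanD.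
  + by move=> i b; rewrite mulrACA -exprMn; exact: pspanZ.
Qed.

(** Powers of [y] below the [p]-th suffice: dividing the exponent by [p], the quotient part is a
    [p]-th power and goes into the coefficient. *)
Lemma pspan_adjoin (I : finType) (e : I -> R) (y : R) : subring (pspan e) ->
  exists (J : finType) (e' : J -> R),
    [/\ subring (pspan e'), pspan e `<=` pspan e' & pspan e' y].
Proof.
move=> [e1 eB eM]; exists (I * 'I_p)%type, (fun ij : I * 'I_p => e ij.1 * y ^+ ij.2).
set e' := fun ij : I * 'I_p => _.
have key x n : pspan e x -> pspan e' (x * y ^+ n).
  move: x; apply: pspan_min.
  - by rewrite mul0r; exact: pspan0.
  - by move=> x z hx hz; rewrite mulrDl; exact: pspanD.
  - move=> i a; have np : (n %% p < p)%N by rewrite ltn_mod prime_gt0.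
    have -> : a ^+ p * e i * y ^+ n =
        (a * y ^+ (n %/ p)) ^+ p * e' (i, Ordinal np).
      by rewrite /e' /= exprMn -exprM {1}(divn_eq n p) exprD; ring.
    exact/pspanZ/pspan_gen.
split; last by rewrite -[y]mul1r -[y]expr1; exact: key.
- apply: pspan_subring; first by rewrite -[1]mulr1 -(expr0 y); exact: key.
  move=> [i a] [j b]; rewrite /e' /= mulrACA -exprD; apply: key.
  by apply: eM; exact: pspan_gen.
- by move=> x ex; rewrite -[x]mulr1 -(expr0 y); exact: key.
Qed.

Lemma F_finite_pgenerates (I : finType) (e : I -> R) : pgenerates p e -> F_finite p R.
Proof.
move=> ge; exists #|I|, (fun i => e (enum_val i)) => x.
have [c ->] := ge x; exists (fun i => c (enum_val i)).
by rewrite /pcomb (reindex (@enum_val I I)) //; apply: onW_bij; exact: enum_val_bij.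
Qed.

Lemma fg_algebra_F_finite (A : comPzRingType) (phi : {rmorphism A -> R}) :
  F_finite p A -> fg_algebra phi -> F_finite p R.
Proof.
move=> [n [a ga]] [k [x gx]].
have [I [e [se pe xe]]] : exists (I : finType) (e : I -> R),
    [/\ subring (pspan e), range phi `<=` pspan e & forall y, y \in codom x -> pspan e y].
  elim: (codom x) => [|y s [I [e [se pe xe]]]].
    exists 'I_n, (phi \o a).
    have pe : range phi `<=` pspan (phi \o a).
      move=> _ [y _ <-]; have [c ->] := ga y; exists (phi \o c) => //.
      by rewrite rmorph_sum; apply: eq_bigr => i _; rewrite rmorphM rmorphXn.
    split=> //; apply: pspan_subring.
      by apply: pe; exists 1 => //; rewrite rmorph1.
    by move=> i j; apply: pe; exists (a i * a j) => //; rewrite rmorphM.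
  have [J [e' [se' ee' ey]]] := pspan_adjoin y se.
  exists J, e'; split=> //; first exact: subset_trans ee'.
  by move=> z; rewrite inE => /orP[/eqP -> //|/xe /ee'].
apply: (@F_finite_pgenerates I e) => y.
have : pspan e y.
  rewrite (gx _ se pe) // => _ [i _ <-]; exact/xe/codom_f.
by move=> [c _ <-]; exists c.
Qed.

Lemma localization_F_finite (P : set R) (S : comPzRingType) (iota : {rmorphism R -> S}) :
  is_localization P iota -> F_finite p R -> F_finite p S.
Proof.
move=> [inv frac _] [n [a ga]]; exists n, (iota \o a) => y.
have [r [s [/inv[v sv] ys]]] := frac y.
(* The fraction [r / s] is rewritten over [s ^+ p], so that its denominator is a [p]-th power. *)
have [c rE] := ga (r * s ^+ p.-1); exists (fun i => v * iota (c i)).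
transitivity (v ^+ p * iota (r * s ^+ p.-1)).
  rewrite rmorphM rmorphXn -ys -{1}[y]mulr1 -{1}(expr1n _ p) -sv exprMn.
  by rewrite -[in iota s ^+ p](prednK (prime_gt0 pp)) exprS; ring.
rewrite rE rmorph_sum mulr_sumr; apply: eq_bigr => i _.
by rewrite rmorphM rmorphXn exprMn mulrA.
Qed.

End FFinite.

Lemma finite_avoid (R : comPzRingType) (P : set R) (I : finType) (Q : I -> R -> Prop) :
  prime_ideal P -> (forall i s t, Q i s -> Q i (s * t)) ->
  (forall i, exists2 s, ~ P s & Q i s) -> exists2 s, ~ P s & forall i, Q i s.
Proof.
move=> pP QM hQ.
suff [s Ps Qs] : exists2 s, ~ P s & forall i, i \in enum I -> Q i s.
  by exists s => // i; apply: Qs; rewrite mem_enum.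
elim: (enum I) => [|i l [s Ps Qs]]; first by exists 1 => //; case: pP.
have [t Pt Qt] := hQ i; exists (t * s); first exact: prime_notM.
move=> j; rewrite inE => /orP[/eqP ->|/Qs]; first exact: QM.
by rewrite mulrC; exact: QM.
Qed.

(** * From local freeness to a global dual basis for Frobenius *)

Section DualBasis.
Variables (p : nat) (R : comPzRingType).
Hypotheses (pp : prime p) (pR : p%:R = 0 :> R).

Definition root_linear (s : nat) (f : R -> R) : Prop :=
  (forall x y, f (x + y) = f x + f y) /\ (forall a x, f (a ^+ (p ^ s) * x) = a * f x).

Definition frobenius_dual_basis : Prop :=
  exists (I : finType) (e : I -> R) (f : I -> R -> R),
    (forall i, root_linear 1 (f i)) /\ forall r, r = \sum_i f i r ^+ p * e i.

Section Relations.
Variables (n : nat) (a : 'I_n -> R).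

Definition prelations : set 'rV[R]_n := [set c | pcomb p a (c ord0) = 0].

Lemma prelations_sub : submodule prelations.
Proof.
split; first by rewrite /prelations /= /pcomb big1 // => i _; rewrite mxE expr0p // mul0r.
move=> x c d hc hd; rewrite /prelations /=.
have -> : (x *: c + d) ord0 = (fun i => x * c ord0 i + d ord0 i).
  by apply/funext => i; rewrite !mxE.
by rewrite pcombD // pcombZ hc hd mulr0 addr0.
Qed.

Lemma noeth_row : noetherian R -> noeth (setT : set 'rV[R]_n).
Proof.
move=> nR; suff -> : (setT : set 'rV[R]_n) = lspan setT [seq delta_mx 0 i | i <- enum 'I_n].
  exact: noeth_lspan.
apply/seteqP; split=> // v _; rewrite (row_sum_delta v).
have h := @lspan_setT_sub R 'rV[R]_n [seq delta_mx 0 i | i <- enum 'I_n].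
apply: submod_sum => // i _; apply: submodZ => //; apply: lspan_mem.
by rewrite map_f // mem_enum.
Qed.

(* [splits g]: multiplication by [g] on [R], viewed as a module through
   Frobenius, factors through a finite free module. *)
Definition splits (g : R) : Prop := exists (I : finType) (e : I -> R) (b : I -> 'I_n -> R),
  (forall c, prelations c -> forall i, \sum_j c ord0 j * b i j = 0) /\
  (forall j, g ^+ p * a j = pcomb p e (fun i => b i j)).

(** Two factorizations are added through the direct sum of the two free modules. *)
Lemma splits_ideal : ideal splits.
Proof.
split.
  exists 'I_0, (fun=> 0), (fun _ _ => 0); split=> [c _ i|j]; first by case: i.
  by rewrite expr0p // mul0r /pcomb big_ord0.
move=> x g h [I [e [b [bc be]]]] [J [e' [b' [bc' be']]]].
exists (I + J)%type, (fun i => match i with inl i => e i | inr i => e' i end),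
  (fun i j => match i with inl i => x * b i j | inr i => b' i j end); split.
  move=> c hc [i|i]; last exact: bc'.
  transitivity (x * \sum_j c ord0 j * b i j); last by rewrite bc // mulr0.
  by rewrite mulr_sumr; apply: eq_bigr => j _; rewrite mulrCA.
move=> j; rewrite /pcomb big_sumType /= -[_ *: _]/(x * g) exprDp // mulrDl be'.
congr (_ + _); rewrite exprMn -mulrA be mulr_sumr; apply: eq_bigr => i _.
by rewrite exprMn mulrA.
Qed.

(** Over the localization a basis [ep] exists; it and the coordinates [be] of the [a j] have
    finitely many denominators, cleared by [t'] and [t]. *)
Lemma splits_local (P : set R) (S : comPzRingType) (iota : {rmorphism R -> S}) :
  noetherian R -> prime_ideal P -> is_localization P iota -> regular_local S ->
  F_finite p R -> exists2 g, ~ P g & splits g.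
Proof.
move=> nR pP loc rS fR.
have fS := localization_F_finite pp loc fR.
have pS : p%:R = 0 :> S by rewrite -(rmorph_nat iota) pR rmorph0.
have [k [ep [ge ef]]] := regular_local_free pp pS rS fS.
have [inv frac tors] := loc.
have /choice[be hbe] : forall j, exists c, iota (a j) = pcomb p ep c.
  by move=> j; exact: ge.
have [t Pt ht] : exists2 t, ~ P t & forall ij : 'I_k * 'I_n,
    exists b, be ij.2 ij.1 * iota t = iota b.
  apply: finite_avoid => // [ij s t [b sb]|ij].
    by exists (b * t); rewrite !rmorphM mulrA sb.
  by have [r [s [Ps h]]] := frac (be ij.2 ij.1); exists s => //; exists r.
have [t' Pt' ht'] : exists2 t, ~ P t & forall i, exists b, ep i * iota t = iota b.
  apply: finite_avoid => // [i s u [b sb]|i].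
    by exists (b * u); rewrite !rmorphM mulrA sb.
  by have [r [s [Ps h]]] := frac (ep i); exists s => //; exists r.
have /choice[b hb] := ht; have /choice[e he] := ht'.
have [l relE] := noeth_row nR prelations_sub (fun _ _ => Logic.I).
(* [Z] lists the finitely many identities wanted over [R]; they hold after localization, so one [s]
   outside [P] kills their defects. As [e i] stands for [ep i] times [t'], the factor [t' ^+ p.-1]
   completes a [p]-th power. *)
pose Z (x : ('I_(size l) * 'I_k) + 'I_n) : R := match x with
  | inl (c, i) => \sum_j (nth 0 l c) ord0 j * b (i, j)
  | inr j => (t * t') ^+ p * a j - \sum_i b (i, j) ^+ p * (t' ^+ p.-1 * e i) end.
have [s Ps hs] : exists2 s, ~ P s & forall x, s * Z x = 0.
  apply: finite_avoid => // [x s u h|x]; first by rewrite mulrAC h mul0r.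
  suff /tors[s [Ps h]] : iota (Z x) = 0 by exists s.
  case: x => [[c i]|j] /=.
    have : prelations (nth 0 l c) by rewrite relE; apply: (@lspan_mem R 'rV[R]_n); exact: mem_nth.
    rewrite /prelations /= => /(congr1 iota); rewrite rmorph0 => h.
    suff /ef/(_ i) h' : pcomb p ep (fun i => \sum_j iota (nth 0 l c ord0 j) * be j i) = 0.
      rewrite -[RHS](mul0r (iota t)) -h' mulr_suml rmorph_sum; apply: eq_bigr => j _.
      by rewrite rmorphM -(hb (i, j)) mulrA.
    rewrite (pcomb_sum pp pS) -[RHS]h /pcomb rmorph_sum; apply: eq_bigr => j _.
    rewrite rmorphM rmorphXn hbe /pcomb mulr_sumr; apply: eq_bigr => i' _.
    by rewrite exprMn mulrA.
  apply/eqP; rewrite rmorphB subr_eq0; apply/eqP.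
  rewrite rmorphM hbe rmorph_sum rmorphXn mulr_sumr; apply: eq_bigr => i _.
  rewrite !rmorphM !rmorphXn -(hb (i, j)) -he /= !exprMn.
  by rewrite -[in iota t' ^+ p](prednK (prime_gt0 pp)) exprS; ring.
exists (s * (t * t')); first by do 2! apply: prime_notM => //.
exists 'I_k, (fun i => t' ^+ p.-1 * e i), (fun i j => s * b (i, j)); split.
  move=> c + i; rewrite relE; move: c.
  apply: (@lspan_subset R 'rV[R]_n l [set c | \sum_j c ord0 j * (s * b (i, j)) = 0]).
    split; rewrite /=; first by rewrite big1 // => j _; rewrite mxE mul0r.
    move=> x c d hc hd; pose v c := \sum_j (c : 'rV[R]_n) ord0 j * (s * b (i, j)).
    transitivity (x * v c + v d); last by rewrite /v hc hd mulr0 addr0.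
    by rewrite mulr_sumr -big_split; apply: eq_bigr => j _; rewrite !mxE /=; ring.
  move=> _ /(nthP 0)[c' lc' <-].
  have := hs (inl (Ordinal lc', i)); rewrite /= mulr_sumr => h.
  by rewrite -[RHS]h; apply: eq_bigr => j _; rewrite mulrCA.
move=> j; have /= := hs (inr j); rewrite mulrBr => /eqP; rewrite subr_eq0 => /eqP h.
rewrite pcombZ exprMn -mulrA -(prednK (prime_gt0 pp)) exprSr -!mulrA.
by rewrite (prednK (prime_gt0 pp)) h.
Qed.

(** The chosen coordinates [c r] on the [a j] are not additive in [r], but [b] kills every relation,
    so their pairings with [b i] are $p^{-1}$-linear. *)
Lemma dual_basis_of_splits : pgenerates p a -> splits 1 -> frobenius_dual_basis.
Proof.
move=> ga [I [e [b [bc be]]]]; have /choice[c hc] := ga.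
exists I, e, (fun i r => \sum_j c r j * b i j).
have rel (d : 'I_n -> R) : pcomb p a d = 0 -> forall i, \sum_j d j * b i j = 0.
  move=> hd i; have hp : prelations (\row_j d j).
    by rewrite /prelations /= -[RHS]hd; congr pcomb; apply/funext => j; rewrite mxE.
  by rewrite -[RHS](bc _ hp i); apply: eq_bigr => j _; rewrite mxE.
split=> [i|r].
  split=> [x y|x y]; apply/eqP; rewrite -subr_eq0; apply/eqP.
    rewrite -big_split -sumrB /= -[RHS](rel (fun j => c (x + y) j - (c x j + c y j)) _ i).
      by apply: eq_bigr => j _; ring.
    by rewrite pcombB // pcombD // -!hc subrr.
  rewrite expn1 mulr_sumr -sumrB -[RHS](rel (fun j => c (x ^+ p * y) j - x * c y j) _ i).
    by apply: eq_bigr => j _; ring.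
  by rewrite pcombB // pcombZ -!hc subrr.
transitivity (pcomb p e (fun i => \sum_j c r j * b i j)); last by [].
rewrite pcomb_sum // {1}(hc r) /pcomb; apply: eq_bigr => j _.
rewrite -[a j]mul1r -{1}(expr1n _ p) be /pcomb mulr_sumr; apply: eq_bigr => i _.
by rewrite exprMn mulrA.
Qed.

End Relations.
(** The ideal [splits] is contained in no prime, by the local case, hence contains 1. *)
Lemma regular_dual_basis : regular_ring R -> F_finite p R -> frobenius_dual_basis.
Proof.
move=> [nR rR] fR; have [n [a ga]] := fR.
apply: (dual_basis_of_splits ga); apply: contrapT => n1.
have [P pP hP] := exists_prime nR (splits_ideal a) n1.
have [S [iota [loc rS]]] := rR P pP.
by have [g Pg /hP] := splits_local a nR pP loc rS fR.
Qed.

End DualBasis.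

(** * Differential operators in characteristic p *)

Section DifferentialOperators.
Variable R : comPzRingType.
Implicit Types (u v : R -> R) (b r : R).

Lemma diffop0 n : diffop n (fun=> 0 : R).
Proof.
elim: n => [|n ih] /=; first by exists 0 => x; rewrite mul0r.
split=> [x y|r]; first by rewrite addr0.
by have -> : (fun=> 0 - r * 0) = (fun=> 0) :> (R -> R) by apply/funext => x; ring.
Qed.

Lemma diffopD n u v : diffop n u -> diffop n v -> diffop n (fun x => u x + v x).
Proof.
elim: n u v => [|n ih] u v /=.
  by move=> [r hr] [r' hr']; exists (r + r') => x; rewrite hr hr' mulrDl.
move=> [uD hu] [vD hv]; split=> [x y|r]; first by rewrite uD vD addrACA.
have -> : (fun x => u (r * x) + v (r * x) - r * (u x + v x)) =
    (fun x => (u (r * x) - r * u x) + (v (r * x) - r * v x)).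
  by apply/funext => x; ring.
exact: ih.
Qed.

Lemma diffopZ n a u : diffop n u -> diffop n (fun x => a * u x).
Proof.
elim: n u => [|n ih] u /=; first by move=> [r hr]; exists (a * r) => x; rewrite hr mulrA.
move=> [uD hu]; split=> [x y|r]; first by rewrite uD mulrDr.
have -> : (fun x => a * u (r * x) - r * (a * u x)) = (fun x => a * (u (r * x) - r * u x)).
  by apply/funext => x; ring.
exact: ih.
Qed.

Lemma diffop_sum n (I : finType) (f : I -> R -> R) :
  (forall i, diffop n (f i)) -> diffop n (fun x => \sum_i f i x).
Proof.
move=> hf; elim: (index_enum I) => [|i l ih].
  have -> : (fun x => \sum_(i <- [::]) f i x) = (fun=> 0).
    by apply/funext => x; rewrite big_nil.
  exact: diffop0.
have -> : (fun x => \sum_(j <- i :: l) f j x) = (fun x => f i x + \sum_(j <- l) f j x).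
  by apply/funext => x; rewrite big_cons.
exact: diffopD.
Qed.

Lemma diffopS n u : diffop n u -> diffop n.+1 u.
Proof.
elim: n u => [|n ih] u.
  move=> [a ua]; split=> [x y|r]; first by rewrite !ua mulrDr.
  by exists 0 => x; rewrite !ua; ring.
by move=> [uD hu]; split=> // r; exact/ih/hu.
Qed.

Lemma diffop_leq n k u : (n <= k)%N -> diffop n u -> diffop k u.
Proof.
move=> /subnKC <- hu; elim: (k - n)%N => [|j ih]; rewrite ?addn0 ?addnS //.
exact: diffopS.
Qed.

Lemma D_R_add u v : D_R u -> D_R v -> D_R (fun x => u x + v x).
Proof.
move=> [n hu] [k hv]; exists (maxn n k); apply: diffopD.
  by apply: diffop_leq hu; exact: leq_maxl.
by apply: diffop_leq hv; exact: leq_maxr.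
Qed.

Definition ad b u : R -> R := fun x => u (b * x) - b * u x.

Lemma ad0 b : ad b (fun=> 0) = fun=> 0.
Proof. by apply/funext => x; rewrite /ad mulr0 subr0. Qed.

Lemma adC b c u : ad b (ad c u) = ad c (ad b u).
Proof. by apply/funext => x; rewrite /ad [c * (b * x)]mulrCA; ring. Qed.

Lemma iter_adC k b c u : iter k (ad b) (ad c u) = ad c (iter k (ad b) u).
Proof. by elim: k => //= k ->; exact: adC. Qed.

(** Multiplying by [b] before and after [u] are commuting operations, so the binomial formula
    expands the iterated commutator. *)
Lemma iter_adE n b u x :
  iter n (ad b) u x = \sum_(i < n.+1) ((- b) ^+ i * u (b ^+ (n - i) * x)) *+ 'C(n, i).
Proof.
elim: n x => [|n ih] x; first by rewrite big_ord1 bin0 !expr0 !mul1r mulr1n.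
rewrite iterS /ad !ih big_ord_recl [RHS]big_ord_recl /= -mulNr mulr_sumr.
rewrite big_ord_recr [in RHS]big_ord_recr /= !binn !bin0 !subnn !subn0 !expr0 !mul1r !mulr1n.
rewrite [b ^+ n.+1]exprSr -!mulrA -!addrA; congr (_ + _).
rewrite addrA -big_split /= /bump /=; congr (_ + _); last by rewrite mulrA -exprS.
apply: eq_bigr => i _; rewrite !add1n binS mulrnDr subSS; congr (_ + _).
  by rewrite mulrA -exprSr subnSK.
by rewrite mulrnAr mulrA -exprS.
Qed.

Section CharP.
Variable p : nat.
Hypotheses (pp : prime p) (pR : p%:R = 0 :> R).

Lemma iter_adp b u : iter p (ad b) u = ad (b ^+ p) u.
Proof.
apply/funext => x; rewrite iter_adE.
have p0 := prime_gt0 pp.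
rewrite -(prednK p0) big_ord_recr big_ord_recl /= (prednK p0).
rewrite !subn0 !subnn !bin0 !binn !expr0 !mulr1n !mul1r.
rewrite big1 => [|i _]; last first.
  have /dvdnP[k ->] : (p %| 'C(p, bump 0 i))%N.
    by apply: prime_dvd_bin => //=; rewrite /bump /= add1n -ltn_predRL ltn_ord.
  by rewrite -mulr_natr natrM pR !mulr0.
rewrite addr0; congr (_ + _); rewrite -mulNr; congr (_ * _).
(* Additivity of Frobenius gives the sign uniformly, including for [p = 2]. *)
by apply/eqP; rewrite -subr_eq0 opprK -exprDp // addNr expr0p.
Qed.

Lemma iter_adpX s b u : iter (p ^ s) (ad b) u = ad (b ^+ (p ^ s)) u.
Proof.
elim: s b => [|s ih] b; first by rewrite expn0 expr1.
rewrite expnSr iterM; have -> : iter p (ad b) = ad (b ^+ p).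
  by apply/funext => v; exact: iter_adp.
by rewrite ih -exprM mulnC.
Qed.

Lemma F_finite_pow s : F_finite p R -> exists (I : finType) (b : I -> R),
  forall r, exists c, r = \sum_i c i ^+ (p ^ s) * b i.
Proof.
move=> [n [a ga]]; elim: s => [|s [I [b gb]]].
  by exists 'I_1, (fun=> 1) => r; exists (fun=> r); rewrite big_ord1 expn0 expr1 mulr1.
have /choice[c hc] := ga; have /choice[d hd] := gb.
exists ('I_n * I)%type, (fun ij => b ij.2 ^+ p * a ij.1) => r.
exists (fun ij => d (c r ij.1) ij.2).
rewrite -(pair_bigA _ (fun i j => d (c r i) j ^+ (p ^ s.+1) * (b j ^+ p * a i))) /=.
rewrite {1}(hc r); apply: eq_bigr => i _; rewrite {1}(hd (c r i)).
rewrite (big_morph (fun x : R => x ^+ p) (exprDp pp pR) (expr0p R pp)) mulr_suml.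
by apply: eq_bigr => j _; rewrite exprMn -exprM -expnSr mulrA.
Qed.

(** Expanding [r] on the [b i] makes the commutator of [u] with [r] a combination of the
    [ad (b i) u], as [u] is linear over [p ^ s]-th powers. Each of these lowers one [e i], whence
    induction on the sum. *)
Lemma nilpotent_diffop (I : finType) (b : I -> R) s :
  (forall r, exists c, r = \sum_i c i ^+ (p ^ s) * b i) ->
  forall (e : I -> nat) u, End_pow p s u -> (forall i, iter (e i) (ad (b i)) u = fun=> 0) ->
  diffop (\sum_i e i)%N u.
Proof.
move=> gb e u; move: {2}(\sum_i e i)%N (erefl (\sum_i e i)%N) => n.
elim: n e u => [|n ih] e u en [uD uZ] hu.
  rewrite en; exists 0 => x; rewrite mul0r.
  (* Either some [e i = 0] forces [u = 0], or the generating family is empty and the ring is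
     zero. *)
  have [i _|I0] := pickP (fun _ : I => true).
    move: en => /eqP; rewrite sum_nat_eq0 => /forallP/(_ i) /= /eqP ei.
    by have := hu i; rewrite ei /= => ->.
  by have [c ->] := gb (u x); rewrite big1 // => i; have := I0 i.
rewrite en; split=> // r; have [c rE] := gb r.
have -> : (fun x => u (r * x) - r * u x) = (fun x => \sum_i c i ^+ (p ^ s) * ad (b i) u x).
  apply/funext => x; rewrite rE !mulr_suml.
  have -> : u (\sum_i c i ^+ (p ^ s) * b i * x) = \sum_i c i ^+ (p ^ s) * u (b i * x).
    rewrite (big_morph u uD (additive0 uD)); apply: eq_bigr => i _.
    by rewrite -mulrA uZ.
  by rewrite -sumrB; apply: eq_bigr => i _; rewrite /ad; ring.
apply: diffop_sum => i; apply: diffopZ.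
have [ei|ei] := posnP (e i).
  have := hu i; rewrite ei /= => ->; rewrite ad0; exact: diffop0.
pose e' j := (e j - (j == i))%N.
have e'n : (\sum_j e' j)%N = n.
  apply: succn_inj; rewrite -en (bigD1 i) //= [RHS](bigD1 i) //= /e' eqxx subn1.
  rewrite -addSn prednK //; congr (_ + _)%N.
  by apply: eq_bigr => j /negPf ->; rewrite subn0.
rewrite -e'n; apply: ih => //.
  split=> [x y|a x]; first by rewrite /ad mulrDr !uD; ring.
  by rewrite /ad mulrCA !uZ; ring.
move=> j; rewrite /e'; case: eqP => [->|_].
  by rewrite -iterSr subn1 prednK.
by rewrite subn0 iter_adC hu ad0.
Qed.

Lemma End_pow_D_R s u : F_finite p R -> End_pow p s u -> D_R u.
Proof.
move=> fR hu; have [I [b gb]] := F_finite_pow s fR.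
exists (\sum_(i : I) p ^ s)%N; apply: (nilpotent_diffop gb) => // i.
rewrite iter_adpX; apply/funext => x; rewrite /ad.
by case: hu => _ ->; rewrite subrr.
Qed.

End CharP.
End DifferentialOperators.

(** * Unit modules *)

Section UnitModules.
Variables (p : nat) (R : comPzRingType).
Hypotheses (pp : prime p) (pR : p%:R = 0 :> R).
Variables (N : lmodType R) (F : {additive N -> N}).
Hypothesis uF : unit_RF_module p F.
Implicit Types (f g : R -> R) (u v : R -> R) (x y : N).

Lemma theta_Fmu s (z : Fpull p s N) : theta p F s (Fmu F z) = z.
Proof. by have [x <-] := theta_surj pp pR uF z; rewrite mu_theta. Qed.

Lemma thetaD s x y : theta p F s (x + y) = theta p F s x + theta p F s y.
Proof.
rewrite -[RHS]theta_Fmu; congr theta.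
by rewrite muD // !mu_theta.
Qed.

Lemma theta_gen s r y : theta p F s (r *: iter s F y) = tens p s r y.
Proof. by rewrite -(muE uF) theta_Fmu. Qed.

(** Bijectivity of [theta] makes the elements [r *: iter s F y] additive generators of [N]; the
    identities below are checked on them. *)
Lemma unit_ind s (P : N -> Prop) : P 0 ->
  (forall r y x, P x -> P (r *: iter s F y + x)) -> forall x, P x.
Proof.
move=> P0 PS x; rewrite -(mu_theta pp pR uF s x).
elim/Fpull_ind: (theta p F s x) => [|r y z ih]; first by rewrite (mu0 uF).
by rewrite (muD uF) (muE uF); exact: PS.
Qed.

(* The map [N -> N], [r F^s(y) |-> f(r) y], induced by a [p^-s]-linear [f]. *)
Definition hom_act s f x : N := tlift (fun r y => f r *: y) (theta p F s x).

Lemma hom_balanced s f : root_linear p s f -> balanced p s (fun r (y : N) => f r *: y).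
Proof.
move=> [fD fZ]; split=> *; first by rewrite fD scalerDl.
- by rewrite scalerDr.
- by rewrite mulrC fZ mulrC scalerA.
Qed.

Lemma hom_actD s f x y : root_linear p s f ->
  hom_act s f (x + y) = hom_act s f x + hom_act s f y.
Proof. by move=> hf; rewrite /hom_act thetaD (tliftD (hom_balanced hf)). Qed.

Lemma hom_act0 s f : root_linear p s f -> hom_act s f 0 = 0.
Proof. by move=> hf; apply: additive0 => x y; exact: hom_actD. Qed.

Lemma hom_act_gen s f r y : root_linear p s f -> hom_act s f (r *: iter s F y) = f r *: y.
Proof. by move=> hf; rewrite /hom_act theta_gen (tliftE (hom_balanced hf)). Qed.

Lemma root_linear_comb s a f g : root_linear p s f -> root_linear p s g ->
  root_linear p s (fun r => a * f r + g r).
Proof.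
move=> [fD fZ] [gD gZ]; split=> [x y|b x]; first by rewrite fD gD; ring.
by rewrite fZ gZ; ring.
Qed.

Lemma root_linear0 s : root_linear p s (fun=> 0 : R).
Proof. by split=> [x y|a x]; rewrite ?addr0 ?mulr0. Qed.

Lemma root_linear_mul s a f : root_linear p s f -> root_linear p s (fun r => f (a * r)).
Proof. by move=> [fD fZ]; split=> [x y|b x]; rewrite ?mulrDr ?fD // mulrCA fZ. Qed.

Lemma root_linear_comp s f g : root_linear p 1 f -> root_linear p s g ->
  root_linear p s.+1 (f \o g).
Proof.
move=> [fD fZ] [gD gZ]; split=> [x y|a x] /=; first by rewrite gD fD.
by rewrite expnS exprM gZ -(fZ a) expn1.
Qed.

Lemma hom_act_comb s a f g x : root_linear p s f -> root_linear p s g ->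
  hom_act s (fun r => a * f r + g r) x = a *: hom_act s f x + hom_act s g x.
Proof.
move=> hf hg; have hfg := root_linear_comb a hf hg; move: x; apply: (unit_ind (s := s)).
  by rewrite !hom_act0 // scaler0 addr0.
move=> r y x ih; rewrite !hom_actD // !hom_act_gen // ih scalerDr.
by rewrite scalerDl scalerA addrACA.
Qed.

Lemma hom_act_zero s x : hom_act s (fun=> 0) x = 0.
Proof. by rewrite /hom_act /tlift big1 // => i _; rewrite scale0r. Qed.

Lemma hom_act_mul s a f x : root_linear p s f ->
  hom_act s f (a *: x) = hom_act s (fun r => f (a * r)) x.
Proof.
move=> hf; have hfa := root_linear_mul a hf; move: x; apply: (unit_ind (s := s)).
  by rewrite scaler0 !hom_act0.
by move=> r y x ih; rewrite scalerDr scalerA !hom_actD // !hom_act_gen // ih.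
Qed.

Lemma hom_act_comp s f g x : root_linear p 1 f -> root_linear p s g ->
  hom_act 1 f (hom_act s g x) = hom_act s.+1 (f \o g) x.
Proof.
move=> hf hg; have hfg := root_linear_comp hf hg; move: x; apply: (unit_ind (s := s.+1)).
  by rewrite !hom_act0.
move=> r y x ih; rewrite !hom_actD // ih iterSr hom_act_gen // -iterSr hom_act_gen //.
by congr (_ + _); exact: (@hom_act_gen 1).
Qed.

Definition root_maps : set (N -> N) :=
  [set h | exists f, root_linear p 1 f /\ h = hom_act 1 f].

Lemma root_maps_semilinear h r x : root_maps h -> r *: h x = h (r ^+ p *: x).
Proof.
move=> [f [hf ->]]; rewrite hom_act_mul //.
have -> : (fun r0 => f (r ^+ p * r0)) = (fun r0 => r * f r0 + 0).
  by apply/funext => b; have := hf.2 r b; rewrite expn1 addr0.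
by rewrite (hom_act_comb _ _ hf (root_linear0 1)) hom_act_zero addr0.
Qed.

(** An element of [N0] is a sum of terms [r *: F y] with [y] in [N0], and each is sent to
    [f r *: y]. *)
Lemma cartier_root_sub N0 : submodule N0 -> N0 `<=` Fpull_image F 1 N0 ->
  cartier root_maps N0 `<=` N0.
Proof.
move=> hN0 sub; apply: submod_span_min => // _ [_ [m [[f [hf ->]] /sub mN0 ->]]].
suff : forall f, root_linear p 1 f -> N0 (hom_act 1 f m) by apply.
apply: (@submod_span_min _ _ _
  [set m | forall f, root_linear p 1 f -> N0 (hom_act 1 f m)]) mN0.
  split=> [g hg|a x y hx hy g hg]; first by rewrite hom_act0 //; exact: hN0.1.
  rewrite hom_actD // hom_act_mul //; apply: submodD => //; last exact: hy.
  by apply: hx; exact: root_linear_mul.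
move=> _ [y Ny <-] g hg; rewrite -[iter 1 F y]scale1r hom_act_gen //.
exact: submodZ.
Qed.

Lemma iterF0 s : iter s F 0 = 0.
Proof. by apply: additive0 => x y; exact: iterFD. Qed.

Lemma image_cartier M j : frobenius_dual_basis p R -> submodule M ->
  Fpull_image F j M `<=` Fpull_image F j.+1 (cartier root_maps M).
Proof.
move=> [I [e [f [hf fE]]]] hM; apply: submod_span_min; first exact: submod_span_sub.
move=> _ [m Mm <-].
(* On [m = r *: F y] this is the dual basis expansion of [r]. *)
have -> : m = \sum_i e i *: F (hom_act 1 (f i) m).
  move: m {Mm}; apply: (unit_ind (s := 1)).
    by rewrite big1 // => i _; rewrite hom_act0 // raddf0 scaler0.
  move=> r y x ih; rewrite {1}ih {1}(fE r) scaler_suml -big_split; apply: eq_bigr => i _ /=.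
  by rewrite hom_actD // (@hom_act_gen 1) // raddfD scalerDr uF.1 scalerA mulrC.
rewrite (big_morph _ (iterFD _ j) (iterF0 j)); apply: submod_sum => [|i _].
  exact: submod_span_sub.
rewrite (iterFZ uF) -iterSr; apply: (submodZ _ (submod_span_sub _)).
apply: submod_span_in; exists (hom_act 1 (f i) m) => //.
by apply: submod_span_in; exists (hom_act 1 (f i)), m; split=> //; exists (f i).
Qed.

Lemma image_iter_cartier M j a : frobenius_dual_basis p R -> submodule M ->
  Fpull_image F j M `<=` Fpull_image F (j + a) (iter a (cartier root_maps) M).
Proof.
move=> db hM; elim: a => [|a ih]; first by rewrite addn0.
apply: subset_trans ih _; rewrite addnS; apply: image_cartier => //.
by case: a => [//|a]; exact: submod_span_sub.
Qed.

(** * From iterated Cartier submodules to differential operators *)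

Section Generators.
Variables (t : nat) (n : 'I_t -> N).

Definition hom_span s : set N :=
  [set m | exists f : 'I_t -> R -> R,
     (forall i, root_linear p s (f i)) /\ m = \sum_i hom_act s (f i) (n i)].

Lemma hom_span_sub s : submodule (hom_span s).
Proof.
split.
  exists (fun _ _ => 0); split=> [i|]; first exact: root_linear0.
  by rewrite big1 // => i _; exact: hom_act_zero.
move=> a _ _ [f [hf ->]] [g [hg ->]]; exists (fun i r => a * f i r + g i r).
split=> [i|]; first exact: root_linear_comb.
by rewrite scaler_sumr -big_split; apply: eq_bigr => i _ /=; rewrite hom_act_comb.
Qed.

Lemma hom_span0 : submod_span (range n) `<=` hom_span 0.
Proof.
apply: submod_span_min; first exact: hom_span_sub.
move=> _ [i _ <-].
have hid : root_linear p 0 (fun r => r) by split.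
exists (fun j => if j == i then fun r => r else fun=> 0); split=> [j|].
  by case: eqP => _; [exact: hid|exact: root_linear0].
rewrite (bigD1 i) //= eqxx -[X in hom_act _ _ X]scale1r.
rewrite (@hom_act_gen 0) // scale1r big1 ?addr0 // => j /negPf ->.
exact: hom_act_zero.
Qed.

Lemma hom_span_cartier s : cartier root_maps (hom_span s) `<=` hom_span s.+1.
Proof.
apply: submod_span_min; first exact: hom_span_sub.
move=> _ [_ [_ [[g [hg ->]] [f [hf ->]] ->]]].
exists (fun i => g \o f i); split=> [i|]; first exact: root_linear_comp.
rewrite (big_morph _ (fun x y => hom_actD x y hg) (hom_act0 hg)).
by apply: eq_bigr => i _; exact: hom_act_comp.
Qed.

Lemma iter_cartier_hom_span s :
  iter s (cartier root_maps) (submod_span (range n)) `<=` hom_span s.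
Proof.
elim: s => [|s ih]; first exact: hom_span0.
by apply: subset_trans (@hom_span_cartier s); exact: cartierS.
Qed.

Lemma End_pow_leq s k u : (s <= k)%N -> End_pow p s u -> End_pow p k u.
Proof.
move=> /subnKC <- hu; elim: (k - s)%N => [|j ih]; rewrite ?addn0 ?addnS //.
exact: End_powS.
Qed.

Lemma D_actD s u x y : End_pow p s u -> D_act p F u (x + y) = D_act p F u x + D_act p F u y.
Proof.
move=> hu; rewrite !(D_actE pp pR uF _ hu) /act_at !(theta_invE pp pR uF) thetaD.
by rewrite -(muD uF); congr Fmu; exact: (tliftD (op_balanced N hu)).
Qed.

Lemma D_act_gen s u r y : End_pow p s u ->
  D_act p F u (r *: iter s F y) = u r *: iter s F y.
Proof.
move=> hu; rewrite (D_actE pp pR uF _ hu) /act_at (theta_invE pp pR uF) theta_gen.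
by rewrite /Fpull_op (tliftE (op_balanced N hu)) (muE uF).
Qed.

Lemma D_act0 s u : End_pow p s u -> D_act p F u 0 = 0.
Proof. by move=> hu; apply: additive0 => x y; exact: (D_actD (s := s)). Qed.

Lemma D_act_comb a u v x : D_R u -> D_R v ->
  D_act p F (fun r => a * u r + v r) x = a *: D_act p F u x + D_act p F v x.
Proof.
move=> /(D_R_End_pow pR)[s1 h1] /(D_R_End_pow pR)[s2 h2].
(* A common exponent lets both operators act through the same [theta]. *)
have hu := End_pow_leq (leq_maxl s1 s2) h1; have hv := End_pow_leq (leq_maxr s1 s2) h2.
move: (maxn s1 s2) hu hv => s hu hv {s1 s2 h1 h2}.
have huv : End_pow p s (fun r => a * u r + v r).
  by split=> [b c|b c]; rewrite ?hu.1 ?hv.1 ?hu.2 ?hv.2; ring.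
move: x; apply: (unit_ind (s := s)).
  by rewrite !(D_act0 (s := s)) // scaler0 addr0.
move=> r y x ih; rewrite !(D_actD (s := s)) // !D_act_gen // ih scalerDr.
by rewrite scalerDl scalerA addrACA.
Qed.

(** On [r *: iter s F y] both sides equal [f r ^+ (p ^ s) *: iter s F y]. *)
Lemma iterF_hom_act s f x : root_linear p s f ->
  iter s F (hom_act s f x) = D_act p F (fun r => f r ^+ (p ^ s)) x.
Proof.
move=> hf; have hu : End_pow p s (fun r => f r ^+ (p ^ s)).
  split=> [a b|a b]; first by rewrite hf.1 exprDpX.
  by rewrite hf.2 exprMn.
move: x; apply: (unit_ind (s := s)).
  by rewrite hom_act0 // (D_act0 hu) iterF0.
move=> r y x ih; rewrite hom_actD // iterFD ih (D_actD _ _ hu) (D_act_gen _ _ hu).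
by rewrite hom_act_gen // (iterFZ uF).
Qed.

Definition D_span : set N := [set x | exists u : 'I_t -> R -> R,
  (forall i, D_R (u i)) /\ x = \sum_i D_act p F (u i) (n i)].

Lemma D_span_sub : submodule D_span.
Proof.
have h0 : End_pow p 0 (fun=> 0 : R) by split=> *; rewrite ?addr0 ?mulr0.
split.
  exists (fun _ _ => 0); split=> [i|]; first by exists 0%N; exact: diffop0.
  rewrite big1 // => i _.
  by rewrite -[n i]scale1r -[1 *: _]/(1 *: iter 0 F (n i)) (D_act_gen _ _ h0) scale0r.
move=> a _ _ [u [hu ->]] [v [hv ->]]; exists (fun i r => a * u i r + v i r).
split=> [i|].
  apply: D_R_add => //; have [k hk] := hu i; exists k; exact: diffopZ.
by rewrite scaler_sumr -big_split; apply: eq_bigr => i _ /=; rewrite D_act_comb.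
Qed.

Lemma image_hom_span s : F_finite p R -> Fpull_image F s (hom_span s) `<=` D_span.
Proof.
move=> fR; apply: submod_span_min; first exact: D_span_sub.
move=> _ [_ [f [hf ->]] <-].
rewrite (big_morph _ (iterFD _ s) (iterF0 s)).
exists (fun i r => f i r ^+ (p ^ s)); split=> [i|].
  apply: (End_pow_D_R pp pR (s := s) fR); have [fD fZ] := hf i.
  by split=> [a b|a b]; rewrite ?fD ?fZ ?exprDpX ?exprMn.
by apply: eq_bigr => i _; exact: iterF_hom_act.
Qed.

End Generators.
End UnitModules.

Theorem corollary4p4 (p : nat) (A : comNzRingType) (R : comPzRingType)
    (phi : {rmorphism A -> R}) (N : lmodType R) (F : {additive N -> N})
    (N0 : set N) (t : nat) (n : 'I_t -> N) :
  p \in [pchar A] ->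
  F_finite p A ->
  regular_local A ->
  regular_ring R ->
  fg_algebra phi ->
  unit_RF_module p F ->
  RF_finitely_generated F ->
  is_root F N0 ->
  N0 = submod_span (range n) ->
  generates_D p F n.
Proof.
move=> /andP[pp /eqP pA] fA _ rR fg uF _ [hN0 fgN0 N0sub N0U] N0E x.
have pR : p%:R = 0 :> R by rewrite -(rmorph_nat phi) pA rmorph0.
have fR := fg_algebra_F_finite pp pR fA fg.
have db := regular_dual_basis pp pR rR fR.
have [nR _] := rR.
have CN0 := cartier_root_sub pp pR uF hN0 N0sub.
have [a ha] := cartier_stable nR (prime_gt1 pp) (@root_maps_semilinear p R pp pR N F uF)
  (noeth_fg nR fgN0) hN0 CN0.
have : (\bigcup_s Fpull_image F s N0) x by rewrite N0U.
move=> [j _ /(image_iter_cartier pp pR uF (a := a) db hN0)].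
(* Stability replaces [a] Cartier steps by [j + a], matching the Frobenius power as [image_hom_span]
   requires. *)
rewrite -(ha (j + a)%N) ?leq_addl // N0E => xj.
apply: (image_hom_span pp pR uF (s := (j + a)%N) fR).
move: xj; apply: submod_span_min; first exact: submod_span_sub.
move=> _ [m Mm <-]; apply: submod_span_in; exists m => //.
exact: (iter_cartier_hom_span pp pR uF Mm).
Qed.
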